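(* If $x>0$ and $\nu\geq\frac{1}{2}$, then $$I_{\nu}(x)K_{\nu}(x)-\frac{1}{2x}<\frac{1}{16x^2}.$$
   Context: $I_\nu$ and $K_\nu$ denote the modified Bessel functions of the first and second kind of order $\nu$. *)

(* Defs.v *)
From Stdlib Require Import Reals Factorial.
From Coquelicot Require Import Coquelicot.
Open Scope R_scope.

(* Euler's limit Gamma(z) = lim n! n^z / (z (z+1) ... (z+n)), valid for every
   real z other than 0, -1, -2, ...; at these poles the value is 0 (as / 0 = 0),
   so that / Gamma z is 0 there, as it should be for the entire function 1/Gamma. *)
Definition Gamma (z : R) : R :=
  real (Lim_seq (fun n : nat =>
    INR (fact n) * Rpower (INR n) z / prod_f_R0 (fun k : nat => z + INR k) n)).

(* Meaningful for x > 0, since Rpower is the real power of a positive base. *)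
Definition BesselI (nu x : R) : R :=
  Series (fun k : nat =>
    Rpower (x / 2) (2 * INR k + nu) / (INR (fact k) * Gamma (INR k + nu + 1))).

Definition BesselK_quot (x nu : R) : R :=
  PI / 2 * ((BesselI (- nu) x - BesselI nu x) / sin (nu * PI)).

(* At integer order the quotient is 0 / 0, and K_nu is its limit as the order
   tends to nu. *)
Definition BesselK (nu x : R) : R :=
  if Req_EM_T (frac_part nu) 0
  then real (Lim (BesselK_quot x) nu)
  else BesselK_quot x nu.

(* Main.v *)
Require Import Defs.
From Stdlib Require Import ZArith Reals Factorial Lra Lia.
From Coquelicot Require Import Coquelicot.
Open Scope R_scope.

(** Write [y x = sqrt x * BesselI nu x]. For noninteger [nu >= 1/2] the Wronskian
    of [BesselI nu] and [BesselI (- nu)], whose constant is given by the reflection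
    formula, yields [(K / I)' = - 1 / y^2]. The modified Bessel equation gives
    [y' >= y], so [K / I - 1 / (2 y^2)] is increasing; as [K / I] tends to [0] at
    infinity it is nonpositive, which is the stronger bound [I K <= 1 / (2 x)].

    That [K / I] tends to [0] means [BesselI (- nu) / BesselI nu] tends to [1].
    The recurrence shows that integer shifts of the order do not change the
    asymptotics; for a fractional shift [d], log-convexity of [Gamma] bounds
    [BesselI (mu + d) / BesselI mu] between [1 - O(1 / mu)] and [1 + O(1 / mu)]
    asymptotically, and one lets [mu] tend to infinity through integer shifts.

    At integer order, log-convexity of [Gamma] also shows that [BesselI] is lower
    semicontinuous in the order from the right, and the bound passes to the limit. *)

(** * The Gamma function *)

Lemma exp_ge_1_plus (u : R) : 1 + u <= exp u.
Proof.
  destruct (Req_dec u 0) as [->|h].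
  - rewrite exp_0; lra.
  - left; now apply exp_ineq1.
Qed.

(** Weighted AM-GM for [1] and [s]: once [Rpower s d] is factored out, bounding both exponentials
    below by [1 + u] makes the terms in [ln s] cancel. *)
Lemma Rpower_bernoulli (s d : R) : 0 < s -> 0 <= d <= 1 ->
  Rpower s d <= 1 - d + d * s.
Proof.
  intros hs hd. unfold Rpower.
  set (L := ln s).
  assert (hs' : s = exp (d * L) * exp (L - d * L)).
  { rewrite <- exp_plus. replace (d * L + (L - d * L)) with L by ring.
    unfold L. now rewrite exp_ln. }
  assert (h1 : 1 = exp (d * L) * exp (- (d * L))).
  { rewrite <- exp_plus, Rplus_opp_r, exp_0. reflexivity. }
  pose proof (exp_ge_1_plus (- (d * L))) as e1.
  pose proof (exp_ge_1_plus (L - d * L)) as e2.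
  pose proof (exp_pos (d * L)) as e3.
  replace (1 - d + d * s) with
    (exp (d * L) * ((1 - d) * exp (- (d * L)) + d * exp (L - d * L))).
  2:{ transitivity ((1 - d) * (exp (d * L) * exp (- (d * L)))
        + d * (exp (d * L) * exp (L - d * L))); [ring|].
      rewrite <- h1, <- hs'. ring. }
  rewrite <- (Rmult_1_r (exp (d * L))) at 1.
  apply Rmult_le_compat_l; [lra|]. nra.
Qed.

Lemma ln_ge_1_minus_inv (s : R) : 0 < s -> 1 - / s <= ln s.
Proof.
  intros hs.
  pose proof (exp_ge_1_plus (- ln s)) as h.
  rewrite exp_Ropp, exp_ln in h; lra.
Qed.

(** Combines [1 + u <= exp u] with [1 - / s <= ln s]. A bound affine in [/ s] suits both uses: it
    matches the denominators of Euler's sequence, and in [BesselI_order_ge] the factor [/ s] lowers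
    the order of a term by one. *)
Lemma Rpower_ge_tangent (s d : R) : 0 < s -> 0 <= d ->
  1 + d * (1 - / s) <= Rpower s d.
Proof.
  intros hs hd. unfold Rpower.
  pose proof (exp_ge_1_plus (d * ln s)).
  pose proof (ln_ge_1_minus_inv s hs). nra.
Qed.

Lemma Rpower_base_1 (d : R) : Rpower 1 d = 1.
Proof. unfold Rpower. now rewrite ln_1, Rmult_0_r, exp_0. Qed.

Lemma Rpower_pos (a b : R) : 0 < Rpower a b.
Proof. apply exp_pos. Qed.

Lemma Rpower_S (a z : R) : 0 < a -> Rpower a (z + 1) = a * Rpower a z.
Proof. intros h. rewrite Rpower_plus, Rpower_1 by assumption. ring. Qed.

(** * Convergence and functional equation of Euler's limit *)

Definition nonpole (z : R) : Prop := forall n : nat, z + INR n <> 0.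

Lemma nonpole_pos (z : R) : 0 < z -> nonpole z.
Proof. intros hz n. pose proof (pos_INR n). lra. Qed.

Lemma nonpole_S (z : R) : nonpole z -> nonpole (z + 1).
Proof. intros h n. specialize (h (S n)). rewrite S_INR in h. lra. Qed.

Lemma nonpole_plus (z : R) (k : nat) : nonpole z -> nonpole (z + INR k).
Proof. intros h n. specialize (h (k + n)%nat). rewrite plus_INR in h. lra. Qed.

(** The body repeats the sequence under the limit in [Gamma], so that [fold] recovers it there. *)
Definition euler_gamma (z : R) (n : nat) : R :=
  INR (fact n) * Rpower (INR n) z / prod_f_R0 (fun k : nat => z + INR k) n.

Lemma prod_f_R0_S (f : nat -> R) (n : nat) :
  prod_f_R0 f (S n) = prod_f_R0 f n * f (S n).
Proof. reflexivity. Qed.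

Lemma rising_neq_0 (z : R) (n : nat) : nonpole z ->
  prod_f_R0 (fun k : nat => z + INR k) n <> 0.
Proof.
  intros hz; induction n as [|n IH]; [|rewrite prod_f_R0_S].
  - apply (hz 0%nat).
  - apply Rmult_integral_contrapositive_currified; [exact IH|exact (hz (S n))].
Qed.

Lemma rising_pos (z : R) (n : nat) : 0 < z ->
  0 < prod_f_R0 (fun k : nat => z + INR k) n.
Proof.
  intros hz; induction n as [|n IH]; [|rewrite prod_f_R0_S].
  - simpl; lra.
  - apply Rmult_lt_0_compat; [exact IH|].
    pose proof (pos_INR (S n)); lra.
Qed.

(** Both sides are [z (z + 1) ... (z + n + 1)]. *)
Lemma rising_shift (z : R) (n : nat) :
  z * prod_f_R0 (fun k : nat => z + 1 + INR k) n =
  prod_f_R0 (fun k : nat => z + INR k) n * (z + 1 + INR n).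
Proof.
  induction n as [|n IH].
  - simpl; ring.
  - rewrite !prod_f_R0_S. rewrite <- Rmult_assoc, IH.
    rewrite S_INR. ring.
Qed.

Lemma one_le_INR (n : nat) : (1 <= n)%nat -> 1 <= INR n.
Proof. intros h. apply (le_INR 1 n h). Qed.

(** The functional equation at finite [n], with a correcting factor that tends to [1]. *)
Lemma euler_gamma_shift (z : R) (n : nat) : nonpole z -> (1 <= n)%nat ->
  euler_gamma (z + 1) n = z * euler_gamma z n * (INR n / (z + 1 + INR n)).
Proof.
  intros hz hn. unfold euler_gamma.
  pose proof (one_le_INR n hn).
  rewrite Rpower_S by lra.
  pose proof (rising_neq_0 z n hz) as h1.
  pose proof (rising_neq_0 (z + 1) n (nonpole_S z hz)) as h2.
  pose proof (nonpole_S z hz n) as h3.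
  pose proof (hz 0%nat) as h4; simpl in h4; rewrite Rplus_0_r in h4.
  pose proof (rising_shift z n) as h5.
  apply (Rmult_eq_reg_r (z * prod_f_R0 (fun k : nat => z + 1 + INR k) n));
    [|now apply Rmult_integral_contrapositive_currified].
  rewrite h5 at 2. field. repeat split; assumption.
Qed.

Lemma euler_gamma_S (z : R) (n : nat) : 0 < z -> (1 <= n)%nat ->
  euler_gamma z (S n) =
  euler_gamma z n * (Rpower (1 + / INR n) z / (1 + z / (INR n + 1))).
Proof.
  intros hz hn. unfold euler_gamma.
  pose proof (one_le_INR n hn).
  rewrite !prod_f_R0_S. rewrite fact_simpl, mult_INR, S_INR.
  pose proof (rising_pos z n hz).
  replace (INR n + 1) with (INR n * (1 + / INR n)) at 2 by (field; lra).
  assert (0 < / INR n) by (apply Rinv_0_lt_compat; lra).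
  rewrite <- Rpower_mult_distr by lra.
  field. repeat split; lra.
Qed.

Lemma euler_gamma_pos (z : R) (n : nat) : 0 < z -> 0 < euler_gamma z n.
Proof.
  intros hz. unfold euler_gamma.
  apply Rdiv_lt_0_compat; [|now apply rising_pos].
  apply Rmult_lt_0_compat; [apply INR_fact_lt_0|apply Rpower_pos].
Qed.

(** The quotient of consecutive terms is at least [1] by [Rpower_ge_tangent] at [s = 1 + / n], where
    [1 - / s] is exactly [/ (n + 1)]. *)
Lemma euler_gamma_incr (z : R) (n : nat) : 0 < z -> (1 <= n)%nat ->
  euler_gamma z n <= euler_gamma z (S n).
Proof.
  intros hz hn. rewrite euler_gamma_S by assumption.
  rewrite <- (Rmult_1_r (euler_gamma z n)) at 1.
  apply Rmult_le_compat_l; [left; now apply euler_gamma_pos|].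
  pose proof (one_le_INR n hn).
  assert (hp : 0 < / INR n) by (apply Rinv_0_lt_compat; lra).
  pose proof (Rpower_ge_tangent (1 + / INR n) z ltac:(lra) ltac:(lra)) as h.
  replace (1 - / (1 + / INR n)) with (/ (INR n + 1)) in h by (field; lra).
  apply Rmult_le_reg_r with (1 + z / (INR n + 1)).
  - assert (0 < z / (INR n + 1)) by (apply Rdiv_lt_0_compat; lra). lra.
  - unfold Rdiv at 2. rewrite Rmult_assoc, Rinv_l.
    + unfold Rdiv. lra.
    + assert (0 < z / (INR n + 1)) by (apply Rdiv_lt_0_compat; lra). lra.
Qed.

(** For [z <= 1], Bernoulli's inequality at [1 + / n] makes this majorant decrease; it therefore
    bounds the increasing Euler sequence. *)
Lemma euler_gamma_majorant_decr (z : R) (n : nat) : 0 < z <= 1 -> (1 <= n)%nat ->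
  euler_gamma z (S n) * (1 + z / INR (S n)) <= euler_gamma z n * (1 + z / INR n).
Proof.
  intros hz hn. rewrite euler_gamma_S by (lra || assumption).
  rewrite S_INR.
  pose proof (one_le_INR n hn).
  assert (hp : 0 < / INR n) by (apply Rinv_0_lt_compat; lra).
  assert (0 < z / (INR n + 1)) by (apply Rdiv_lt_0_compat; lra).
  pose proof (Rpower_bernoulli (1 + / INR n) z ltac:(lra) ltac:(lra)) as h.
  rewrite Rmult_assoc.
  apply Rmult_le_compat_l; [left; apply euler_gamma_pos; lra|].
  unfold Rdiv at 1. rewrite Rmult_assoc, Rinv_l by lra.
  unfold Rdiv. lra.
Qed.

Lemma euler_gamma_bounded (z : R) (n : nat) : 0 < z <= 1 ->
  euler_gamma z (S n) <= euler_gamma z 1 * (1 + z).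
Proof.
  intros hz.
  assert (h : euler_gamma z (S n) * (1 + z / INR (S n)) <= euler_gamma z 1 * (1 + z)).
  { induction n as [|n IH].
    - simpl INR. right. field.
    - eapply Rle_trans; [|exact IH].
      apply euler_gamma_majorant_decr; [exact hz|lia]. }
  eapply Rle_trans; [|exact h].
  rewrite <- (Rmult_1_r (euler_gamma z (S n))) at 1.
  apply Rmult_le_compat_l; [left; apply euler_gamma_pos; lra|].
  assert (0 < z / INR (S n)) by (apply Rdiv_lt_0_compat; [lra|apply lt_0_INR; lia]).
  lra.
Qed.

(** The limit is required to be nonzero because reciprocals of [Gamma] are the coefficients of the
    Bessel series. *)
Definition gamma_converges (z : R) : Prop :=
  exists l : R, l <> 0 /\ is_lim_seq (euler_gamma z) l.

Lemma gamma_converges_unit (z : R) : 0 < z <= 1 -> gamma_converges z.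
Proof.
  intros hz.
  (* The sequence is taken from index [1], since at index [0] the base [INR 0] of [Rpower] is not
     positive. *)
  destruct (ex_finite_lim_seq_incr (fun n => euler_gamma z (S n))
    (euler_gamma z 1 * (1 + z))) as [l hl].
  - intros n. apply euler_gamma_incr; [lra|lia].
  - intros n. now apply euler_gamma_bounded.
  - exists l. split.
    + assert (h : euler_gamma z 1 <= l).
      { apply (is_lim_seq_incr_compare (fun n => euler_gamma z (S n)) l hl) with (n := 0%nat).
        intros n. apply euler_gamma_incr; [lra|lia]. }
      pose proof (euler_gamma_pos z 1 ltac:(lra)). lra.
    + now apply is_lim_seq_incr_1.
Qed.

Lemma is_lim_seq_inv_INR (a : R) : is_lim_seq (fun n => / (a + INR n)) 0.
Proof.
  replace (Finite 0) with (Rbar_inv p_infty) by reflexivity.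
  apply is_lim_seq_inv; [|discriminate].
  apply is_lim_seq_plus with (l1 := a) (l2 := p_infty);
    [apply is_lim_seq_const|apply is_lim_seq_INR|reflexivity].
Qed.

Lemma is_lim_seq_shift_ratio (a : R) : is_lim_seq (fun n => INR n / (a + INR n)) 1.
Proof.
  apply is_lim_seq_ext_loc with (fun n => 1 - a * / (a + INR n)).
  - assert (h : is_lim_seq (fun n => a + INR n) p_infty).
    { apply is_lim_seq_plus with (l1 := a) (l2 := p_infty);
        [apply is_lim_seq_const|apply is_lim_seq_INR|reflexivity]. }
    apply is_lim_seq_spec in h. destruct (h 0) as [N hN].
    exists N. intros n hn. specialize (hN n hn). field. lra.
  - replace (Finite 1) with (Finite (1 - a * 0)) by (f_equal; ring).
    apply is_lim_seq_minus'; [apply is_lim_seq_const|].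
    apply is_lim_seq_mult'; [apply is_lim_seq_const|].
    apply is_lim_seq_inv_INR.
Qed.

Lemma is_lim_euler_gamma_S (z l : R) : nonpole z ->
  is_lim_seq (euler_gamma z) l -> is_lim_seq (euler_gamma (z + 1)) (z * l).
Proof.
  intros hz hl.
  apply is_lim_seq_ext_loc with
    (fun n => z * euler_gamma z n * (INR n / (z + 1 + INR n))).
  - exists 1%nat. intros n hn. symmetry. now apply euler_gamma_shift.
  - replace (Finite (z * l)) with (Finite (z * l * 1)) by (f_equal; ring).
    apply is_lim_seq_mult'; [|apply is_lim_seq_shift_ratio].
    apply is_lim_seq_mult'; [apply is_lim_seq_const|exact hl].
Qed.

Lemma gamma_converges_S (z : R) : nonpole z ->
  gamma_converges z -> gamma_converges (z + 1).
Proof.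
  intros hz [l [l0 hl]]. exists (z * l). split.
  - apply Rmult_integral_contrapositive_currified; [|exact l0].
    pose proof (hz 0%nat) as h; simpl in h; lra.
  - now apply is_lim_euler_gamma_S.
Qed.

(** The shift identity read backwards; this carries convergence from the positive axis to the left,
    between the poles. *)
Lemma gamma_converges_pred (z : R) : nonpole z ->
  gamma_converges (z + 1) -> gamma_converges z.
Proof.
  intros hz [l [l0 hl]].
  pose proof (hz 0%nat) as z0; simpl in z0; rewrite Rplus_0_r in z0.
  exists (l / z). split.
  - apply Rmult_integral_contrapositive_currified; [exact l0|].
    now apply Rinv_neq_0_compat.
  - apply is_lim_seq_ext_loc with
      (fun n => euler_gamma (z + 1) n / z / (INR n / (z + 1 + INR n))).
    + exists 1%nat. intros n hn. rewrite euler_gamma_shift by assumption.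
      pose proof (one_le_INR n hn).
      pose proof (nonpole_S z hz n). field. repeat split; lra.
    + replace (Finite (l / z)) with (Finite (l / z / 1)) by (f_equal; field; lra).
      apply is_lim_seq_div'; [|apply is_lim_seq_shift_ratio|lra].
      apply is_lim_seq_div'; [exact hl|apply is_lim_seq_const|exact z0].
Qed.

Lemma gamma_converges_pos (n : nat) (z : R) : 0 < z <= INR n -> gamma_converges z.
Proof.
  revert z. induction n as [|n IH]; intros z hz.
  - simpl in hz; lra.
  - rewrite S_INR in hz.
    destruct (Rle_dec z 1) as [h|h]; [apply gamma_converges_unit; lra|].
    replace z with (z - 1 + 1) by ring.
    apply gamma_converges_S; [apply nonpole_pos; lra|apply IH; lra].
Qed.

(** Here [n] bounds the number of unit shifts to the right that bring [z] to the positive axis. *)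
Lemma gamma_converges_nonpole_aux (n : nat) (z : R) : - INR n < z -> nonpole z ->
  gamma_converges z.
Proof.
  revert z. induction n as [|n IH]; intros z hz hp.
  - destruct (INR_archimed 1 z ltac:(lra)) as [m hm].
    apply gamma_converges_pos with m. simpl in hz. lra.
  - rewrite S_INR in hz. apply gamma_converges_pred; [exact hp|].
    apply IH; [lra|now apply nonpole_S].
Qed.

Lemma gamma_converges_nonpole (z : R) : nonpole z -> gamma_converges z.
Proof.
  intros hz. destruct (INR_archimed 1 (- z) ltac:(lra)) as [m hm].
  apply gamma_converges_nonpole_aux with m; [lra|exact hz].
Qed.

Lemma is_lim_seq_Gamma (z : R) : nonpole z -> is_lim_seq (euler_gamma z) (Gamma z).
Proof.
  intros hz. destruct (gamma_converges_nonpole z hz) as [l [_ hl]].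
  replace (Gamma z) with l; [exact hl|].
  unfold Gamma. fold (euler_gamma z). now rewrite (is_lim_seq_unique _ _ hl).
Qed.

Lemma Gamma_neq_0 (z : R) : nonpole z -> Gamma z <> 0.
Proof.
  intros hz. destruct (gamma_converges_nonpole z hz) as [l [l0 hl]].
  unfold Gamma. fold (euler_gamma z). now rewrite (is_lim_seq_unique _ _ hl).
Qed.

Lemma Gamma_S (z : R) : nonpole z -> Gamma (z + 1) = z * Gamma z.
Proof.
  intros hz.
  pose proof (is_lim_euler_gamma_S z _ hz (is_lim_seq_Gamma z hz)) as h.
  unfold Gamma at 1. fold (euler_gamma (z + 1)).
  now rewrite (is_lim_seq_unique _ _ h).
Qed.

Lemma Gamma_pos (z : R) : 0 < z -> 0 < Gamma z.
Proof.
  intros hz.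
  assert (h : 0 <= Gamma z).
  { apply (is_lim_seq_le (fun _ => 0) (euler_gamma z) 0 (Gamma z)).
    - intros n; left; now apply euler_gamma_pos.
    - apply is_lim_seq_const.
    - now apply is_lim_seq_Gamma, nonpole_pos. }
  pose proof (Gamma_neq_0 z (nonpole_pos z hz)). lra.
Qed.

(** * Log-convexity of [Gamma] *)

(** Bernoulli's inequality at [1 + / b] compares one factor with the next; over [b = a, ..., a + n]
    the powers telescope to [Rpower a d] and [Rpower (a + n + 1) d]. *)
Lemma rising_interpolation (a d : R) (n : nat) : 0 < a -> 0 <= d <= 1 ->
  prod_f_R0 (fun k : nat => a + INR k) n * Rpower (a + INR n + 1) d
  <= Rpower a d * prod_f_R0 (fun k : nat => a + d + INR k) n.
Proof.
  intros ha hd.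
  assert (step : forall b, 0 < b -> b * Rpower (b + 1) d <= Rpower b d * (b + d)).
  { intros b hb.
    assert (0 < / b) by (now apply Rinv_0_lt_compat).
    replace (b + 1) with (b * (1 + / b)) by (field; lra).
    rewrite <- Rpower_mult_distr by lra.
    pose proof (Rpower_bernoulli (1 + / b) d ltac:(lra) hd) as h.
    pose proof (Rpower_pos b d).
    replace (b * (Rpower b d * Rpower (1 + / b) d))
      with (Rpower b d * (b * Rpower (1 + / b) d)) by ring.
    apply Rmult_le_compat_l; [lra|].
    replace (b + d) with (b * (1 - d + d * (1 + / b))) by (field; lra).
    apply Rmult_le_compat_l; lra. }
  induction n as [|n IH].
  - simpl. rewrite !Rplus_0_r. now apply step.
  - rewrite !prod_f_R0_S.
    pose proof (pos_INR n) as hn.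
    pose proof (step (a + INR (S n)) ltac:(rewrite S_INR; lra)) as hs.
    pose proof (rising_pos a n ha) as hp.
    rewrite Rmult_assoc.
    apply Rle_trans with (prod_f_R0 (fun k : nat => a + INR k) n *
      (Rpower (a + INR (S n)) d * (a + INR (S n) + d))).
    + apply Rmult_le_compat_l; lra.
    + rewrite <- Rmult_assoc.
      replace (a + d + INR (S n)) with (a + INR (S n) + d) by ring.
      rewrite <- Rmult_assoc.
      apply Rmult_le_compat_r; [pose proof (pos_INR (S n)); lra|].
      rewrite S_INR, <- Rplus_assoc. exact IH.
Qed.

(** Wendel's inequality, the form in which log-convexity is used. It is the limit of
    [rising_interpolation], weakened by [n <= a + n + 1]. *)
Lemma Gamma_interpolation (a d : R) : 0 < a -> 0 <= d <= 1 ->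
  Gamma (a + d) <= Rpower a d * Gamma a.
Proof.
  intros ha hd.
  apply (is_lim_seq_le_loc (euler_gamma (a + d)) (fun n => Rpower a d * euler_gamma a n)
           (Gamma (a + d)) (Rpower a d * Gamma a)).
  - exists 1%nat. intros n hn.
    pose proof (one_le_INR n hn) as hn'.
    unfold euler_gamma. rewrite Rpower_plus.
    pose proof (rising_pos a n ha) as h1.
    pose proof (rising_pos (a + d) n ltac:(lra)) as h2.
    pose proof (rising_interpolation a d n ha hd) as h3.
    assert (h4 : Rpower (INR n) d <= Rpower (a + INR n + 1) d)
      by (apply Rle_Rpower_l; lra).
    set (P := prod_f_R0 (fun k => a + INR k) n) in *.
    set (Q := prod_f_R0 (fun k => a + d + INR k) n) in *.
    assert (h5 : P * Rpower (INR n) d <= Rpower a d * Q).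
    { eapply Rle_trans; [|exact h3]. apply Rmult_le_compat_l; lra. }
    assert (h6 : 0 < INR (fact n) * Rpower (INR n) a / (P * Q)).
    { apply Rdiv_lt_0_compat; [|nra].
      apply Rmult_lt_0_compat; [apply INR_fact_lt_0|apply Rpower_pos]. }
    replace (INR (fact n) * (Rpower (INR n) a * Rpower (INR n) d) / Q) with
      (INR (fact n) * Rpower (INR n) a / (P * Q) * (P * Rpower (INR n) d))
      by (field; lra).
    replace (Rpower a d * (INR (fact n) * Rpower (INR n) a / P)) with
      (INR (fact n) * Rpower (INR n) a / (P * Q) * (Rpower a d * Q))
      by (field; lra).
    apply Rmult_le_compat_l; lra.
  - apply is_lim_seq_Gamma, nonpole_pos; lra.
  - apply is_lim_seq_mult'; [apply is_lim_seq_const|].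
    apply is_lim_seq_Gamma, nonpole_pos; lra.
Qed.

(** * The reflection formula *)

(** Iterating the recurrence of these integrals in [n] produces Euler's product for the sine. *)
Definition cos_moment (z : R) (n : nat) : R :=
  RInt (fun t => cos (2 * z * t) * cos t ^ n) 0 (PI / 2).

Lemma cos_moment_continuous (z : R) (n : nat) (t : R) :
  continuous (fun t => cos (2 * z * t) * cos t ^ n) t.
Proof. apply (ex_derive_continuous (V := R_NormedModule)). auto_derive. trivial. Qed.

Lemma cos_moment_ex (z : R) (n : nat) :
  ex_RInt (fun t => cos (2 * z * t) * cos t ^ n) 0 (PI / 2).
Proof.
  apply (ex_RInt_continuous (V := R_CompleteNormedModule)).
  intros t _. apply cos_moment_continuous.
Qed.

(** Two integrations by parts, packaged as one antiderivative [Phi] that vanishes at both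
    endpoints. *)
Lemma cos_moment_rec (z : R) (n : nat) :
  ((INR n + 2) ^ 2 - 4 * z ^ 2) * cos_moment z (n + 2) =
  (INR n + 2) * (INR n + 1) * cos_moment z n.
Proof.
  set (m := INR n + 2).
  set (Phi := fun t => m * cos (2 * z * t) * cos t ^ (n + 1) * sin t
                       - 2 * z * sin (2 * z * t) * cos t ^ (n + 2)).
  set (phi := fun t => (m ^ 2 - 4 * z ^ 2) * (cos (2 * z * t) * cos t ^ (n + 2))
                       - m * (INR n + 1) * (cos (2 * z * t) * cos t ^ n)).
  assert (h : is_RInt phi 0 (PI / 2) (Phi (PI / 2) - Phi 0)).
  { apply (is_RInt_derive (V := R_CompleteNormedModule) Phi phi).
    - intros t _. unfold Phi, phi. auto_derive; [trivial|].
      replace (Init.Nat.pred (n + 1)) with n by lia.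
      replace (Init.Nat.pred (n + 2)) with (n + 1)%nat by lia.
      rewrite !plus_INR, !pow_add. simpl INR. unfold m.
      pose proof (sin2_cos2 t) as hs. unfold Rsqr in hs.
      replace (cos t ^ 2) with (1 - sin t * sin t) by (simpl; lra).
      replace (cos t ^ 1) with (cos t) by (simpl; ring).
      (* The two sides differ by a multiple of [1 - sin t ^ 2 - cos t ^ 2]. *)
      apply Rminus_diag_uniq.
      transitivity ((INR n + 2) * cos (2 * z * t) * cos t ^ n
        * (1 - sin t * sin t - cos t * cos t) * (-1)).
      + ring.
      + replace (cos t * cos t) with (1 - sin t * sin t) by lra. ring.
    - intros t _. unfold phi.
      apply (ex_derive_continuous (V := R_NormedModule)). auto_derive. trivial. }
  assert (h0 : Phi (PI / 2) - Phi 0 = 0).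
  { unfold Phi. rewrite cos_PI2, sin_0, !Rmult_0_r, sin_0.
    rewrite !pow_add. simpl. ring. }
  rewrite h0 in h.
  assert (h' : RInt phi 0 (PI / 2) =
     (m ^ 2 - 4 * z ^ 2) * cos_moment z (n + 2) - m * (INR n + 1) * cos_moment z n).
  { unfold phi, cos_moment.
    apply is_RInt_unique.
    apply (is_RInt_minus (V := R_NormedModule)); apply (is_RInt_scal (V := R_NormedModule));
      apply (RInt_correct (V := R_CompleteNormedModule)); apply cos_moment_ex. }
  rewrite (is_RInt_unique _ _ _ _ h) in h'. unfold m in *. lra.
Qed.

Lemma cos_moment_0_0 : cos_moment 0 0 = PI / 2.
Proof.
  unfold cos_moment. rewrite (RInt_ext _ (fun _ => 1)).
  - rewrite RInt_const. unfold scal; simpl; unfold mult; simpl. ring.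
  - intros t _. rewrite Rmult_0_r, Rmult_0_l, cos_0. simpl. ring.
Qed.

Lemma cos_moment_z_0 (z : R) : 2 * z * cos_moment z 0 = sin (PI * z).
Proof.
  assert (h : is_RInt (fun t => 2 * z * (cos (2 * z * t) * cos t ^ 0)) 0 (PI / 2)
     (sin (2 * z * (PI / 2)) - sin (2 * z * 0))).
  { apply (is_RInt_derive (V := R_CompleteNormedModule) (fun t => sin (2 * z * t))).
    - intros t _. auto_derive; [trivial|]. ring.
    - intros t _. apply (ex_derive_continuous (V := R_NormedModule)).
      auto_derive. trivial. }
  apply (is_RInt_unique (V := R_CompleteNormedModule)) in h.
  rewrite (RInt_scal (V := R_CompleteNormedModule) (fun t => cos (2 * z * t) * cos t ^ 0))
    in h by apply cos_moment_ex.
  rewrite Rmult_0_r, sin_0, Rminus_0_r in h.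
  unfold cos_moment. unfold scal in h; simpl in h; unfold mult in h; simpl in h.
  etransitivity; [exact h|]. f_equal. field.
Qed.

Lemma cos_moment_0_pos (n : nat) : 0 < cos_moment 0 (2 * n).
Proof.
  induction n as [|n IH].
  - simpl Nat.mul. rewrite cos_moment_0_0. pose proof PI_RGT_0; lra.
  - pose proof (cos_moment_rec 0 (2 * n)) as h.
    replace (2 * S n)%nat with (2 * n + 2)%nat by lia.
    pose proof (pos_INR (2 * n)).
    set (a := INR (2 * n)) in *.
    apply Rmult_lt_reg_l with ((a + 2) ^ 2 - 4 * 0 ^ 2); [nra|].
    rewrite h, Rmult_0_r. apply Rmult_lt_0_compat; [nra|exact IH].
Qed.

(** The difference [sin t - t cos t] vanishes at [0] and has derivative [t sin t]. *)
Lemma mul_cos_le_sin (t : R) : 0 <= t <= PI / 2 -> t * cos t <= sin t.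
Proof.
  intros ht.
  destruct (MVT_gen (fun t => sin t - t * cos t) 0 t (fun t => t * sin t)) as [c [hc h]].
  - intros s _. auto_derive; [trivial|]. ring.
  - intros s _. apply derivable_continuous_pt, ex_derive_Reals_0. auto_derive. trivial.
  - rewrite Rmin_left, Rmax_right in hc by lra.
    rewrite sin_0 in h.
    pose proof PI_RGT_0.
    assert (0 <= sin c) by (apply sin_ge_0; lra).
    assert (0 <= c * sin c * (t - 0)) by (repeat apply Rmult_le_pos; lra).
    lra.
Qed.

Lemma Rabs_sin_le (u : R) : Rabs (sin u) <= Rabs u.
Proof.
  assert (h : forall v, 0 <= v -> Rabs (sin v) <= v).
  { intros v hv. destruct (Req_dec v 0) as [->|hv0].
    - rewrite sin_0, Rabs_R0. lra.
    - pose proof (sin_lt_x v ltac:(lra)).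
      destruct (Rle_dec v 1) as [h1|h1].
      + assert (0 <= sin v).
        { apply sin_ge_0; [lra|]. pose proof PI2_1. lra. }
        rewrite Rabs_pos_eq; lra.
      + pose proof (SIN_bound v). apply Rabs_le. lra. }
  destruct (Rle_dec 0 u) as [hu|hu].
  - rewrite (Rabs_pos_eq u) by lra. now apply h.
  - rewrite <- (Rabs_Ropp (sin u)), <- sin_neg, (Rabs_left u) by lra.
    apply h; lra.
Qed.

Lemma one_minus_cos_bounds (z t : R) : 0 <= 1 - cos (2 * z * t) <= 2 * z ^ 2 * t ^ 2.
Proof.
  replace (2 * z * t) with (2 * (z * t)) by ring.
  rewrite cos_2a_sin.
  pose proof (Rabs_sin_le (z * t)) as h.
  apply Rsqr_le_abs_1 in h. unfold Rsqr in h. nra.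
Qed.

(** Large powers of the cosine concentrate at [0], where [cos (2 z t)] is near [1]. Quantitatively,
    [1 - cos (2 z t) <= 2 z ^ 2 t ^ 2] and [t cos t <= sin t] bound the loss by [2 z ^ 2] times the
    difference of two consecutive even moments at [z = 0], which the recurrence evaluates. *)
Lemma cos_moment_near (z : R) (n : nat) :
  Rabs (cos_moment z (2 * n + 2) / cos_moment 0 (2 * n + 2) - 1)
  <= 2 * z ^ 2 * / (INR n + 1).
Proof.
  pose proof (cos_moment_0_pos (S n)) as hp.
  replace (2 * S n)%nat with (2 * n + 2)%nat in hp by lia.
  pose proof PI_RGT_0 as hpi.
  pose proof (cos_moment_ex z (2 * n + 2)) as e1.
  pose proof (cos_moment_ex 0 (2 * n + 2)) as e2.
  pose proof (cos_moment_ex 0 (2 * n)) as e3.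
  assert (hpt : forall t, cos (2 * 0 * t) = 1).
  { intros t. rewrite Rmult_0_r, Rmult_0_l. apply cos_0. }
  assert (h1 : cos_moment z (2 * n + 2) <= cos_moment 0 (2 * n + 2)).
  { apply RInt_le; [lra|exact e1|exact e2|]. intros t ht. rewrite hpt.
    pose proof (one_minus_cos_bounds z t).
    apply Rmult_le_compat_r; [|lra]. apply pow_le, cos_ge_0; lra. }
  assert (h2 : cos_moment 0 (2 * n + 2) - cos_moment z (2 * n + 2) <=
     2 * z ^ 2 * (cos_moment 0 (2 * n) - cos_moment 0 (2 * n + 2))).
  { unfold cos_moment.
    rewrite <- (RInt_minus (V := R_CompleteNormedModule)
      (fun t => cos (2 * 0 * t) * cos t ^ (2 * n + 2))) by assumption.
    rewrite <- (RInt_minus (V := R_CompleteNormedModule)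
      (fun t => cos (2 * 0 * t) * cos t ^ (2 * n))) by assumption.
    assert (e4 : ex_RInt (fun t : R => minus (cos (2 * 0 * t) * cos t ^ (2 * n))
       (cos (2 * 0 * t) * cos t ^ (2 * n + 2))) 0 (PI / 2))
       by (apply (ex_RInt_minus (V := R_NormedModule)); assumption).
    rewrite <- (RInt_scal (V := R_CompleteNormedModule) (fun t : R => minus _ _)
      0 (PI / 2) (2 * z ^ 2)) by assumption.
    apply RInt_le; [lra| |apply (ex_RInt_scal (V := R_NormedModule)); assumption|].
    - apply (ex_RInt_minus (V := R_NormedModule)); assumption.
    - intros t ht. unfold minus, plus, opp, scal, mult; simpl; unfold mult; simpl.
      change (n + (n + 0))%nat with (2 * n)%nat.
      rewrite hpt.
      pose proof (one_minus_cos_bounds z t) as [_ hb].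
      assert (hc : 0 <= cos t) by (apply cos_ge_0; lra).
      assert (hs : t * cos t <= sin t) by (apply mul_cos_le_sin; lra).
      assert (hcp : 0 <= cos t ^ (2 * n)) by now apply pow_le.
      rewrite pow_add.
      pose proof (sin2_cos2 t) as hsc. unfold Rsqr in hsc.
      set (P := cos t ^ (2 * n)) in *. set (c := cos t) in *. set (s := sin t) in *.
      assert (hs2 : (t * c) * (t * c) <= s * s) by (apply Rmult_le_compat; nra).
      (* The factor [c ^ 2] absorbs [t ^ 2] through [t c <= s], and [s ^ 2 = 1 - c ^ 2] turns the
         bound into the difference of the integrands. *)
      apply Rle_trans with (2 * z ^ 2 * t ^ 2 * (P * c ^ 2)).
      + replace (1 * (P * c ^ 2) + - (cos (2 * z * t) * (P * c ^ 2)))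
          with ((1 - cos (2 * z * t)) * (P * c ^ 2)) by ring.
        apply Rmult_le_compat_r; [|exact hb]. nra.
      + replace (1 * P + - (1 * (P * c ^ 2))) with (P * (s * s)).
        2:{ replace (s * s) with (1 - c * c) by lra. ring. }
        replace (2 * z ^ 2 * t ^ 2 * (P * c ^ 2)) with
          (2 * z ^ 2 * P * (t * c * (t * c))) by ring.
        replace (2 * (z * (z * 1)) * (P * (s * s))) with (2 * z ^ 2 * P * (s * s)) by ring.
        apply Rmult_le_compat_l; [|exact hs2].
        apply Rmult_le_pos; [nra|exact hcp]. }
  pose proof (cos_moment_rec 0 (2 * n)) as hr.
  rewrite mult_INR in hr. simpl (INR 2) in hr.
  pose proof (pos_INR n) as hn.
  set (X := cos_moment 0 (2 * n + 2)) in *.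
  set (Y := cos_moment z (2 * n + 2)) in *.
  set (U := cos_moment 0 (2 * n)) in *.
  assert (hU : U = X * (2 * INR n + 2) / (2 * INR n + 1)).
  { apply (Rmult_eq_reg_l ((2 * INR n + 2) * (2 * INR n + 1))); [|nra].
    transitivity (((1 + 1) * INR n + 2) * ((1 + 1) * INR n + 1) * U); [ring|].
    rewrite <- hr. field. lra. }
  assert (h3 : U - X <= X * / (INR n + 1)).
  { rewrite hU.
    replace (X * (2 * INR n + 2) / (2 * INR n + 1) - X) with (X * / (2 * INR n + 1))
      by (field; lra).
    apply Rmult_le_compat_l; [lra|]. apply Rinv_le_contravar; lra. }
  rewrite Rabs_left1.
  - apply Rmult_le_reg_l with X; [exact hp|].
    replace (X * - (Y / X - 1)) with (X - Y) by (field; lra).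
    eapply Rle_trans; [exact h2|].
    replace (X * (2 * z ^ 2 * / (INR n + 1))) with (2 * z ^ 2 * (X * / (INR n + 1))) by ring.
    apply Rmult_le_compat_l; [nra|exact h3].
  - apply Rmult_le_reg_l with X; [exact hp|].
    replace (X * (Y / X - 1)) with (Y - X) by (field; lra). lra.
Qed.

(** Dividing the recurrence at [z] by the one at [0] leaves the factor [1 - z ^ 2 / (m + 1) ^ 2];
    the starting values [cos_moment z 0] and [cos_moment 0 0] supply [sin (PI z)] and [PI]. *)
Lemma sin_finite_product (z : R) (n : nat) :
  sin (PI * z) * INR (fact (S n)) ^ 2 =
  PI * z * prod_f_R0 (fun k => 1 + z + INR k) n * prod_f_R0 (fun k => 1 - z + INR k) n
    * (cos_moment z (2 * n + 2) / cos_moment 0 (2 * n + 2)).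
Proof.
  assert (step : forall m, cos_moment z (2 * m) / cos_moment 0 (2 * m) * (INR m + 1) ^ 2 =
     (1 + z + INR m) * (1 - z + INR m) *
      (cos_moment z (2 * m + 2) / cos_moment 0 (2 * m + 2))).
  { intros m.
    pose proof (cos_moment_rec z (2 * m)) as h1.
    pose proof (cos_moment_rec 0 (2 * m)) as h0.
    pose proof (cos_moment_0_pos m) as p0.
    pose proof (cos_moment_0_pos (S m)) as p1.
    replace (2 * S m)%nat with (2 * m + 2)%nat in p1 by lia.
    rewrite mult_INR in h1, h0. simpl (INR 2) in h1, h0.
    pose proof (pos_INR m).
    set (X := cos_moment 0 (2 * m + 2)) in *.
    set (Y := cos_moment z (2 * m + 2)) in *.
    set (U := cos_moment 0 (2 * m)) in *.
    set (V := cos_moment z (2 * m)) in *.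
    set (a := INR m) in *.
    assert (e0 : X = (2 * a + 1) / (2 * a + 2) * U).
    { apply (Rmult_eq_reg_l ((2 * a + 2) ^ 2)); [|nra].
      transitivity (((((1 + 1) * a + 2)) ^ 2 - 4 * 0 ^ 2) * X); [ring|].
      rewrite h0. field. lra. }
    assert (e1 : (1 + z + a) * (1 - z + a) * Y = (a + 1) * (2 * a + 1) / 2 * V) by nra.
    replace ((1 + z + a) * (1 - z + a) * (Y / X)) with
      ((1 + z + a) * (1 - z + a) * Y / X) by (field; lra).
    rewrite e1, e0. field. lra. }
  induction n as [|n IH].
  - pose proof (step 0%nat) as h. simpl Nat.mul in *. simpl Nat.add in *.
    simpl INR in h. rewrite cos_moment_0_0 in h.
    rewrite <- cos_moment_z_0. simpl prod_f_R0. simpl INR.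
    transitivity (PI * z * ((1 + z + 0) * (1 - z + 0) * (cos_moment z 2 / cos_moment 0 2)));
      [|ring].
    rewrite <- h. field. apply PI_neq0.
  - pose proof (step (S n)) as h.
    replace (2 * S n)%nat with (2 * n + 2)%nat in h by lia.
    replace (2 * S n)%nat with (2 * n + 2)%nat by lia.
    rewrite fact_simpl, mult_INR.
    rewrite !prod_f_R0_S.
    rewrite Rpow_mult_distr.
    replace (sin (PI * z) * (INR (S (S n)) ^ 2 * INR (fact (S n)) ^ 2)) with
      (sin (PI * z) * INR (fact (S n)) ^ 2 * INR (S (S n)) ^ 2) by ring.
    rewrite IH, (S_INR (S n)).
    transitivity (PI * z * prod_f_R0 (fun k => 1 + z + INR k) n *
       prod_f_R0 (fun k => 1 - z + INR k) n *
       (cos_moment z (2 * n + 2) / cos_moment 0 (2 * n + 2) * (INR (S n) + 1) ^ 2));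
      [ring|].
    rewrite h. ring.
Qed.

(** One sequence is given two limits: its Euler factors converge to [Gamma], while the finite sine
    product rewrites it as [PI z] times a moment ratio tending to [1] and the square of
    [n / (1 + n)]. That square comes from [n ^ 2], the product of the two powers of [n], against the
    extra factor in [(n + 1)!]. *)
Lemma Gamma_reflection (z : R) : nonpole (1 + z) -> nonpole (1 - z) ->
  sin (PI * z) * (Gamma (1 + z) * Gamma (1 - z)) = PI * z.
Proof.
  intros hp hm.
  assert (l1 : is_lim_seq (fun n => sin (PI * z) *
      (euler_gamma (1 + z) n * euler_gamma (1 - z) n))
      (sin (PI * z) * (Gamma (1 + z) * Gamma (1 - z)))).
  { apply is_lim_seq_mult'; [apply is_lim_seq_const|].
    apply is_lim_seq_mult'; now apply is_lim_seq_Gamma. }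
  assert (l0 : is_lim_seq (fun n => / (INR n + 1)) 0).
  { apply is_lim_seq_ext with (fun n => / (1 + INR n)); [intros n; f_equal; ring|].
    apply is_lim_seq_inv_INR. }
  assert (l2 : is_lim_seq (fun n => cos_moment z (2 * n + 2) / cos_moment 0 (2 * n + 2)) 1).
  { apply is_lim_seq_ext with
      (fun n => (cos_moment z (2 * n + 2) / cos_moment 0 (2 * n + 2) - 1) + 1);
      [intros n; ring|].
    replace (Finite 1) with (Finite (0 + 1)) by (f_equal; ring).
    apply is_lim_seq_plus'; [|apply is_lim_seq_const].
    apply is_lim_seq_abs_0.
    apply is_lim_seq_le_le with (fun _ => 0) (fun n => 2 * z ^ 2 * / (INR n + 1)).
    - intros n. split; [apply Rabs_pos|apply cos_moment_near].
    - apply is_lim_seq_const.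
    - replace (Finite 0) with (Finite (2 * z ^ 2 * 0)) by (f_equal; ring).
      apply is_lim_seq_mult'; [apply is_lim_seq_const|exact l0]. }
  assert (l3 : is_lim_seq (fun n => sin (PI * z) *
      (euler_gamma (1 + z) n * euler_gamma (1 - z) n)) (PI * z)).
  { apply is_lim_seq_ext_loc with (fun n => PI * z *
      (cos_moment z (2 * n + 2) / cos_moment 0 (2 * n + 2))
      * ((INR n / (1 + INR n)) * (INR n / (1 + INR n)))).
    - exists 1%nat. intros n hn. unfold euler_gamma.
      pose proof (one_le_INR n hn).
      pose proof (rising_neq_0 _ n hp) as hP.
      pose proof (rising_neq_0 _ n hm) as hM.
      pose proof (sin_finite_product z n) as h.
      assert (hr : Rpower (INR n) (1 + z) * Rpower (INR n) (1 - z) = INR n ^ 2).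
      { rewrite <- Rpower_plus. replace (1 + z + (1 - z)) with (INR 2) by (simpl; ring).
        apply Rpower_pow; lra. }
      rewrite fact_simpl, mult_INR, S_INR in h.
      set (P := prod_f_R0 (fun k => 1 + z + INR k) n) in *.
      set (M := prod_f_R0 (fun k => 1 - z + INR k) n) in *.
      set (q := cos_moment z (2 * n + 2) / cos_moment 0 (2 * n + 2)) in *.
      transitivity (sin (PI * z) * INR (fact n) ^ 2 *
        (Rpower (INR n) (1 + z) * Rpower (INR n) (1 - z)) / (P * M));
        [|field; split; assumption].
      rewrite hr.
      replace (sin (PI * z) * INR (fact n) ^ 2) with
        (sin (PI * z) * ((INR n + 1) * INR (fact n)) ^ 2 / (INR n + 1) ^ 2)
        by (field; lra).
      rewrite h. field. repeat split; try assumption; lra.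
    - replace (Finite (PI * z)) with (Finite (PI * z * 1 * (1 * 1))) by (f_equal; ring).
      apply is_lim_seq_mult'.
      + apply is_lim_seq_mult'; [apply is_lim_seq_const|exact l2].
      + apply is_lim_seq_mult'; apply is_lim_seq_shift_ratio. }
  apply is_lim_seq_unique in l1. apply is_lim_seq_unique in l3.
  rewrite l1 in l3. now injection l3.
Qed.

(** * The Bessel series *)

Definition bessel_coef (mu : R) (k : nat) : R :=
  / (INR (fact k) * Gamma (INR k + mu + 1)).

(** The Bessel-Clifford function: [BesselI mu x] without its factor [Rpower (x / 2) mu], in the
    variable [t = x ^ 2 / 4]. It is a power series regular at [0], and differentiating it raises the
    order by one. *)
Definition bessel_series (mu t : R) : R := PSeries (bessel_coef mu) t.

Lemma nonpole_order (mu : R) (k : nat) : nonpole (mu + 1) -> nonpole (INR k + mu + 1).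
Proof.
  intros h. replace (INR k + mu + 1) with (mu + 1 + INR k) by ring.
  now apply nonpole_plus.
Qed.

Lemma bessel_coef_neq_0 (mu : R) (k : nat) : nonpole (mu + 1) -> bessel_coef mu k <> 0.
Proof.
  intros h. apply Rinv_neq_0_compat.
  apply Rmult_integral_contrapositive_currified.
  - apply INR_fact_neq_0.
  - now apply Gamma_neq_0, nonpole_order.
Qed.

Lemma bessel_coef_S (mu : R) (k : nat) : nonpole (mu + 1) ->
  bessel_coef mu (S k) = bessel_coef mu k * (/ (1 + INR k) * / (mu + 1 + INR k)).
Proof.
  intros h. unfold bessel_coef.
  rewrite fact_simpl, mult_INR, S_INR.
  replace (INR k + 1 + mu + 1) with (INR k + mu + 1 + 1) by ring.
  rewrite Gamma_S by now apply nonpole_order.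
  pose proof (Gamma_neq_0 _ (nonpole_order mu k h)).
  pose proof (INR_fact_neq_0 k).
  pose proof (nonpole_order mu k h 0%nat) as h'. simpl in h'.
  pose proof (pos_INR k).
  field. repeat split; try assumption; lra.
Qed.

Lemma bessel_coef_radius (mu : R) : nonpole (mu + 1) ->
  CV_radius (bessel_coef mu) = p_infty.
Proof.
  intros h. apply CV_radius_infinite_DAlembert.
  - intros n. now apply bessel_coef_neq_0.
  - apply -> is_lim_seq_abs_0.
    apply is_lim_seq_ext with (fun n => / (1 + INR n) * / (mu + 1 + INR n)).
    + intros n. rewrite bessel_coef_S by assumption.
      pose proof (bessel_coef_neq_0 mu n h).
      pose proof (h n). pose proof (pos_INR n).
      field. repeat split; try assumption; lra.
    + replace (Finite 0) with (Finite (0 * 0)) by (f_equal; ring).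
      apply is_lim_seq_mult'; apply is_lim_seq_inv_INR.
Qed.

Lemma ex_pseries_bessel (mu t : R) : nonpole (mu + 1) -> ex_pseries (bessel_coef mu) t.
Proof.
  intros h. apply CV_radius_inside. rewrite bessel_coef_radius by assumption. exact I.
Qed.

Lemma is_derive_bessel_series (mu t : R) : nonpole (mu + 1) ->
  is_derive (bessel_series mu) t (bessel_series (mu + 1) t).
Proof.
  intros h. unfold bessel_series.
  rewrite (PSeries_ext (bessel_coef (mu + 1)) (PS_derive (bessel_coef mu))).
  - apply is_derive_PSeries. rewrite bessel_coef_radius by assumption. exact I.
  - intros n. unfold PS_derive, bessel_coef.
    rewrite fact_simpl, mult_INR, S_INR.
    replace (INR n + 1 + mu + 1) with (INR n + (mu + 1) + 1) by ring.
    pose proof (Gamma_neq_0 _ (nonpole_order (mu + 1) n (nonpole_S _ h))).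
    pose proof (INR_fact_neq_0 n). pose proof (pos_INR n).
    field. repeat split; try assumption; lra.
Qed.

(** Coefficientwise this is [Gamma (k + mu + 2) = (k + mu + 1) Gamma (k + mu + 1)], the summand [k]
    cancelling against [k!]. Since differentiation raises the order, it is also the modified Bessel
    equation. *)
Lemma bessel_series_rec (mu t : R) : nonpole (mu + 1) ->
  bessel_series mu t =
  (mu + 1) * bessel_series (mu + 1) t + t * bessel_series (mu + 2) t.
Proof.
  intros h. unfold bessel_series.
  assert (h2 : nonpole (mu + 1 + 1)) by now apply nonpole_S.
  assert (h3 : nonpole (mu + 2 + 1)).
  { replace (mu + 2 + 1) with (mu + 1 + 1 + 1) by ring. now apply nonpole_S. }
  rewrite <- PSeries_scal, <- PSeries_incr_1.
  rewrite <- PSeries_plus.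
  - apply PSeries_ext. intros n.
    unfold PS_plus, PS_scal, PS_incr_1.
    unfold plus, scal; simpl; unfold mult; simpl.
    unfold bessel_coef at 1 2.
    replace (INR n + (mu + 1) + 1) with (INR n + mu + 1 + 1) by ring.
    rewrite (Gamma_S (INR n + mu + 1)) by now apply nonpole_order.
    pose proof (Gamma_neq_0 _ (nonpole_order mu n h)).
    pose proof (nonpole_order mu n h 0%nat) as h'. simpl in h'.
    (* The shifted series has constant coefficient [0], so this index is treated apart. *)
    destruct n as [|n].
    + unfold zero; simpl. simpl in *. field. repeat split; try assumption; lra.
    + unfold bessel_coef. rewrite fact_simpl, mult_INR.
      replace (INR n + (mu + 2) + 1) with (INR (S n) + mu + 1 + 1) by (rewrite S_INR; ring).
      rewrite (Gamma_S (INR (S n) + mu + 1)) by now apply nonpole_order.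
      pose proof (INR_fact_neq_0 n). pose proof (pos_INR n).
      rewrite S_INR in *. field. repeat split; try assumption; lra.
  - apply ex_pseries_scal; [apply Rmult_comm|]. now apply ex_pseries_bessel.
  - apply ex_pseries_incr_1. now apply ex_pseries_bessel.
Qed.

Lemma bessel_series_0 (mu : R) : bessel_series mu 0 = / Gamma (mu + 1).
Proof.
  unfold bessel_series. rewrite PSeries_0. unfold bessel_coef. simpl.
  f_equal. rewrite Rplus_0_l. ring.
Qed.

Lemma Series_ge_head (a : nat -> R) : (forall n, 0 <= a n) -> ex_series a ->
  a 0%nat <= Series a.
Proof.
  intros ha hs.
  pose proof (Series_correct a hs) as h.
  rewrite <- (sum_O a).
  apply (is_lim_seq_incr_compare (sum_n a) (Series a) h).
  intros n. rewrite sum_Sn. unfold plus; simpl. pose proof (ha (S n)). lra.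
Qed.

Lemma bessel_coef_pos (mu : R) (k : nat) : -1 < mu -> 0 < bessel_coef mu k.
Proof.
  intros h. apply Rinv_0_lt_compat, Rmult_lt_0_compat; [apply INR_fact_lt_0|].
  apply Gamma_pos. pose proof (pos_INR k). lra.
Qed.

Lemma bessel_series_pos (mu t : R) : -1 < mu -> 0 <= t -> 0 < bessel_series mu t.
Proof.
  intros h ht. unfold bessel_series, PSeries.
  eapply Rlt_le_trans; [|apply Series_ge_head].
  - simpl. rewrite Rmult_1_r. now apply bessel_coef_pos.
  - intros n. apply Rmult_le_pos; [left; now apply bessel_coef_pos|now apply pow_le].
  - apply ex_pseries_R, ex_pseries_bessel, nonpole_pos. lra.
Qed.

Lemma bessel_term_factor (mu x : R) (k : nat) : 0 < x ->
  Rpower (x / 2) (2 * INR k + mu) / (INR (fact k) * Gamma (INR k + mu + 1)) =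
  Rpower (x / 2) mu * (bessel_coef mu k * (x ^ 2 / 4) ^ k).
Proof.
  intros hx. rewrite Rpower_plus.
  replace (2 * INR k) with (INR (2 * k)) by (rewrite mult_INR; simpl; ring).
  rewrite Rpower_pow, pow_mult by lra.
  replace ((x / 2) ^ 2) with (x ^ 2 / 4) by field.
  unfold bessel_coef, Rdiv. ring.
Qed.

Lemma BesselI_series (mu x : R) : 0 < x ->
  BesselI mu x = Rpower (x / 2) mu * bessel_series mu (x ^ 2 / 4).
Proof.
  intros hx. unfold BesselI.
  erewrite Series_ext; [|intros k; now apply bessel_term_factor].
  apply Series_scal_l.
Qed.

Lemma ex_series_BesselI (mu x : R) : 0 < x -> nonpole (mu + 1) ->
  ex_series (fun k : nat =>
    Rpower (x / 2) (2 * INR k + mu) / (INR (fact k) * Gamma (INR k + mu + 1))).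
Proof.
  intros hx h.
  eapply ex_series_ext; [intros k; symmetry; now apply bessel_term_factor|].
  apply (ex_series_scal (V := R_NormedModule)).
  now apply ex_pseries_R, ex_pseries_bessel.
Qed.

Lemma BesselI_pos (mu x : R) : 0 < x -> -1 < mu -> 0 < BesselI mu x.
Proof.
  intros hx h. rewrite BesselI_series by assumption.
  apply Rmult_lt_0_compat; [apply Rpower_pos|]. apply bessel_series_pos; nra.
Qed.

Lemma BesselI_rec (mu x : R) : 0 < x -> nonpole (mu + 1) ->
  BesselI mu x = 2 * (mu + 1) / x * BesselI (mu + 1) x + BesselI (mu + 2) x.
Proof.
  intros hx h. rewrite !BesselI_series by assumption.
  rewrite bessel_series_rec by assumption.
  replace (mu + 2) with (mu + 1 + 1) by ring.
  rewrite !Rpower_S by lra. field. lra.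
Qed.

Lemma is_derive_bessel_series_sq (mu x : R) : nonpole (mu + 1) ->
  is_derive (fun x => bessel_series mu (x ^ 2 / 4)) x
    (x / 2 * bessel_series (mu + 1) (x ^ 2 / 4)).
Proof.
  intros h.
  evar_last.
  - apply (is_derive_comp (bessel_series mu) (fun x => x ^ 2 / 4)).
    + now apply is_derive_bessel_series.
    + auto_derive; [trivial|reflexivity].
  - unfold scal; simpl; unfold mult; simpl. field.
Qed.

(** * The Wronskian *)

(** The left side is [x] times the Wronskian of [BesselI nu] and [BesselI (- nu)], written at
    [t = x ^ 2 / 4]. Its derivative vanishes by the recurrence, so its value can be read off at
    [t = 0]. *)
Lemma bessel_wronskian (nu t : R) : nonpole (1 + nu) -> nonpole (1 - nu) ->
  2 * t * (bessel_series nu t * bessel_series (- nu + 1) t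
           - bessel_series (nu + 1) t * bessel_series (- nu) t)
  - 2 * nu * bessel_series nu t * bessel_series (- nu) t = - 2 * sin (PI * nu) / PI.
Proof.
  intros hp hm.
  assert (hp1 : nonpole (nu + 1)) by (now rewrite Rplus_comm).
  assert (hm1 : nonpole (- nu + 1)) by (now rewrite Rplus_comm).
  pose proof (nonpole_S _ hp1) as hp2. pose proof (nonpole_S _ hm1) as hm2.
  set (Om := fun t => 2 * t * (bessel_series nu t * bessel_series (- nu + 1) t
           - bessel_series (nu + 1) t * bessel_series (- nu) t)
           - 2 * nu * bessel_series nu t * bessel_series (- nu) t).
  assert (hd : forall s, is_derive Om s zero).
  { intros s. unfold Om.
    pose proof (is_derive_bessel_series nu s hp1) as d1.
    pose proof (is_derive_bessel_series (nu + 1) s hp2) as d2.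
    pose proof (is_derive_bessel_series (- nu) s hm1) as d3.
    pose proof (is_derive_bessel_series (- nu + 1) s hm2) as d4.
    auto_derive.
    - repeat split; eexists; eassumption.
    - rewrite (is_derive_unique (fun x : R => bessel_series nu x) _ _ d1),
        (is_derive_unique (fun x : R => bessel_series (nu + 1) x) _ _ d2),
        (is_derive_unique (fun x : R => bessel_series (- nu) x) _ _ d3),
        (is_derive_unique (fun x : R => bessel_series (- nu + 1) x) _ _ d4).
      pose proof (bessel_series_rec nu s hp1) as r1.
      pose proof (bessel_series_rec (- nu) s hm1) as r2.
      replace (nu + 1 + 1) with (nu + 2) by ring.
      replace (- nu + 1 + 1) with (- nu + 2) by ring.
      rewrite r1, r2. unfold zero; simpl. ring. }
  (* At [0] only [- 2 nu / (Gamma (1 + nu) Gamma (1 - nu))] remains, which the reflection formula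
     evaluates. *)
  assert (h0 : Om 0 = - 2 * sin (PI * nu) / PI).
  { unfold Om. rewrite !bessel_series_0.
    rewrite (Rplus_comm nu 1), (Rplus_comm (- nu) 1).
    change (1 + - nu) with (1 - nu).
    pose proof (Gamma_reflection nu hp hm) as hr.
    pose proof (Gamma_neq_0 _ hp). pose proof (Gamma_neq_0 _ hm).
    pose proof PI_neq0.
    assert (Gamma (1 + nu + 1) <> 0) by (apply Gamma_neq_0; now apply nonpole_S).
    assert (Gamma (1 - nu + 1) <> 0) by (apply Gamma_neq_0; now apply nonpole_S).
    transitivity (- 2 * (PI * nu) / (PI * (Gamma (1 + nu) * Gamma (1 - nu)))).
    - field. repeat split; assumption.
    - rewrite <- hr at 1. field. repeat split; assumption. }
  change (Om t = - 2 * sin (PI * nu) / PI). rewrite <- h0.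
  destruct (Rtotal_order t 0) as [h|[->|h]].
  - apply (eq_is_derive (V := R_NormedModule) Om t 0); auto.
  - reflexivity.
  - symmetry. apply (eq_is_derive (V := R_NormedModule) Om 0 t); auto.
Qed.

(** * Differential inequalities for the series *)

(** With the integrating factor [exp s], the product [exp s * f s] is nondecreasing from a positive
    value. *)
Lemma positive_of_derive_ge_opp (f df : R -> R) (x : R) :
  (forall s, is_derive f s (df s)) -> (forall s, 0 <= s -> 0 <= df s + f s) ->
  0 < f 0 -> 0 <= x -> 0 < f x.
Proof.
  intros hd hge h0 hx.
  destruct (MVT_gen (fun s => exp s * f s) 0 x (fun s => exp s * (df s + f s)))
    as [c [hc h]].
  - intros s _. pose proof (hd s) as d. auto_derive; [eexists; eassumption|].
    rewrite (is_derive_unique (fun x : R => f x) _ _ d). ring.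
  - intros s _. apply derivable_continuous_pt, ex_derive_Reals_0.
    auto_derive. eexists; apply hd.
  - rewrite Rmin_left, Rmax_right in hc by lra.
    rewrite exp_0 in h.
    assert (0 <= exp c * (df c + f c) * (x - 0)).
    { apply Rmult_le_pos; [|lra]. apply Rmult_le_pos; [left; apply exp_pos|].
      apply hge; lra. }
    apply Rmult_lt_reg_l with (exp x); [apply exp_pos|]. lra.
Qed.

(** Up to a power of [x / 2] this is [BesselI (nu + 1) x < BesselI nu x]. For the difference [f],
    the recurrence reduces [f' + f] to [(nu + 1 / 2) * bessel_series (nu + 1)]. *)
Lemma bessel_series_order_decr (nu x : R) : 0 <= nu -> 0 <= x ->
  0 < bessel_series nu (x ^ 2 / 4) - x / 2 * bessel_series (nu + 1) (x ^ 2 / 4).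
Proof.
  intros hn hx.
  assert (p1 : nonpole (nu + 1)) by (apply nonpole_pos; lra).
  pose proof (nonpole_S _ p1) as p2.
  apply (positive_of_derive_ge_opp
    (fun x => bessel_series nu (x ^ 2 / 4) - x / 2 * bessel_series (nu + 1) (x ^ 2 / 4))
    (fun x => x / 2 * bessel_series (nu + 1) (x ^ 2 / 4)
       - (/ 2 * bessel_series (nu + 1) (x ^ 2 / 4)
          + x / 2 * (x / 2 * bessel_series (nu + 1 + 1) (x ^ 2 / 4))))).
  - intros s. apply (is_derive_minus (V := R_NormedModule)).
    + exact (is_derive_bessel_series_sq nu s p1).
    + apply (is_derive_mult (fun x : R => x / 2)
        (fun x : R => bessel_series (nu + 1) (x ^ 2 / 4)) s (/ 2));
        [|exact (is_derive_bessel_series_sq (nu + 1) s p2)|intros; apply Rmult_comm].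
      auto_derive; [trivial|]. field.
  - intros s hs.
    pose proof (bessel_series_rec nu (s ^ 2 / 4) p1) as r.
    replace (nu + 1 + 1) with (nu + 2) by ring.
    assert (hp : 0 < bessel_series (nu + 1) (s ^ 2 / 4)) by (apply bessel_series_pos; nra).
    rewrite r. nra.
  - replace (0 ^ 2 / 4) with 0 by field.
    pose proof (bessel_series_pos nu 0 ltac:(lra) ltac:(lra)). lra.
  - exact hx.
Qed.

(* Up to a positive factor, this is [y' - y] for [y x = sqrt x * BesselI nu x]. *)
Lemma bessel_series_log_derive (nu x : R) : 1 / 2 <= nu -> 0 <= x ->
  0 < (nu + 1 / 2) * bessel_series nu (x ^ 2 / 4)
      + x ^ 2 / 2 * bessel_series (nu + 1) (x ^ 2 / 4) - x * bessel_series nu (x ^ 2 / 4).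
Proof.
  intros hn hx.
  assert (p1 : nonpole (nu + 1)) by (apply nonpole_pos; lra).
  pose proof (nonpole_S _ p1) as p2.
  apply (positive_of_derive_ge_opp
    (fun x => (nu + 1 / 2) * bessel_series nu (x ^ 2 / 4)
      + x ^ 2 / 2 * bessel_series (nu + 1) (x ^ 2 / 4) - x * bessel_series nu (x ^ 2 / 4))
    (fun x => (nu + 1 / 2) * (x / 2 * bessel_series (nu + 1) (x ^ 2 / 4))
      + (x * bessel_series (nu + 1) (x ^ 2 / 4)
         + x ^ 2 / 2 * (x / 2 * bessel_series (nu + 1 + 1) (x ^ 2 / 4)))
      - (1 * bessel_series nu (x ^ 2 / 4)
         + x * (x / 2 * bessel_series (nu + 1) (x ^ 2 / 4))))).
  - intros s. apply (is_derive_minus (V := R_NormedModule));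
      [apply (is_derive_plus (V := R_NormedModule))|].
    + apply (is_derive_scal (fun x : R => bessel_series nu (x ^ 2 / 4))).
      exact (is_derive_bessel_series_sq nu s p1).
    + apply (is_derive_mult (fun x : R => x ^ 2 / 2)
        (fun x : R => bessel_series (nu + 1) (x ^ 2 / 4)) s s);
        [|exact (is_derive_bessel_series_sq (nu + 1) s p2)|intros; apply Rmult_comm].
      auto_derive; [trivial|]. field.
    + apply (is_derive_mult (fun x : R => x)
        (fun x : R => bessel_series nu (x ^ 2 / 4)) s 1);
        [|exact (is_derive_bessel_series_sq nu s p1)|intros; apply Rmult_comm].
      auto_derive; [trivial|]. reflexivity.
  - intros s hs.
    pose proof (bessel_series_rec nu (s ^ 2 / 4) p1) as r.
    pose proof (bessel_series_order_decr nu s ltac:(lra) hs) as hH.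
    replace (nu + 1 + 1) with (nu + 2) by ring.
    set (A := bessel_series nu (s ^ 2 / 4)) in *.
    set (A1 := bessel_series (nu + 1) (s ^ 2 / 4)) in *.
    set (A2 := bessel_series (nu + 2) (s ^ 2 / 4)) in *.
    replace (s ^ 2 / 2 * (s / 2 * A2)) with (s * (A - (nu + 1) * A1))
      by (rewrite r; field).
    (* The sum of the function and its derivative collapses to this product, whose sign is where
       [1 / 2 <= nu] enters. *)
    match goal with |- 0 <= ?e =>
      replace e with ((nu - 1 / 2) * (A - s / 2 * A1)) by field end.
    apply Rmult_le_pos; lra.
  - replace (0 ^ 2 / 4) with 0 by field.
    pose proof (bessel_series_pos nu 0 ltac:(lra) ltac:(lra)). nra.
  - exact hx.
Qed.

Lemma BesselI_S_le (nu x : R) : 0 <= nu -> 0 < x -> BesselI (nu + 1) x <= BesselI nu x.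
Proof.
  intros hn hx. rewrite !BesselI_series, Rpower_S by lra.
  pose proof (bessel_series_order_decr nu x hn ltac:(lra)).
  pose proof (Rpower_pos (x / 2) nu). nra.
Qed.

(** A restatement of [bessel_series_log_derive]; with [BesselI_S_le] it squeezes the ratio of
    consecutive orders to [1] at infinity. *)
Lemma BesselI_S_ge (nu x : R) : 1 / 2 <= nu -> 0 < x ->
  (1 - (nu + 1 / 2) / x) * BesselI nu x <= BesselI (nu + 1) x.
Proof.
  intros hn hx. rewrite !BesselI_series, Rpower_S by lra.
  pose proof (bessel_series_log_derive nu x hn ltac:(lra)) as h.
  pose proof (Rpower_pos (x / 2) nu).
  apply Rmult_le_reg_l with x; [exact hx|].
  set (A := bessel_series nu (x ^ 2 / 4)) in *.
  set (A1 := bessel_series (nu + 1) (x ^ 2 / 4)) in *.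
  set (p := Rpower (x / 2) nu) in *.
  replace (x * ((1 - (nu + 1 / 2) / x) * (p * A))) with (p * (x * A - (nu + 1 / 2) * A))
    by (field; lra).
  replace (x * (x / 2 * p * A1)) with (p * (x ^ 2 / 2 * A1)) by field.
  apply Rmult_le_compat_l; lra.
Qed.

(** * Dependence on the order *)

Definition bessel_term (mu x : R) (k : nat) : R :=
  Rpower (x / 2) (2 * INR k + mu) / (INR (fact k) * Gamma (INR k + mu + 1)).

Lemma bessel_term_pos (mu x : R) (k : nat) : -1 < mu -> 0 < bessel_term mu x k.
Proof.
  intros h. apply Rdiv_lt_0_compat; [apply Rpower_pos|].
  apply Rmult_lt_0_compat; [apply INR_fact_lt_0|].
  apply Gamma_pos. pose proof (pos_INR k). lra.
Qed.

Lemma bessel_term_plus (mu d x : R) (k : nat) : -1 < mu -> 0 <= d ->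
  bessel_term (mu + d) x k =
  bessel_term mu x k *
    (Rpower (x / 2) d * Gamma (INR k + mu + 1) / Gamma (INR k + mu + 1 + d)).
Proof.
  intros h hd. unfold bessel_term. pose proof (pos_INR k).
  rewrite <- Rplus_assoc, Rpower_plus.
  replace (INR k + (mu + d) + 1) with (INR k + mu + 1 + d) by ring.
  pose proof (Gamma_pos (INR k + mu + 1) ltac:(lra)).
  pose proof (Gamma_pos (INR k + mu + 1 + d) ltac:(lra)).
  pose proof (INR_fact_neq_0 k).
  field. repeat split; try assumption; lra.
Qed.

Lemma bessel_term_S (mu x : R) (k : nat) : 0 < x -> -1 < mu ->
  bessel_term (mu + 1) x k = bessel_term mu x k * (x / 2 / (INR k + mu + 1)).
Proof.
  intros hx h. rewrite bessel_term_plus by lra.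
  pose proof (pos_INR k).
  rewrite Rpower_1 by lra.
  rewrite (Gamma_S (INR k + mu + 1)) by (apply nonpole_pos; lra).
  pose proof (Gamma_pos (INR k + mu + 1) ltac:(lra)).
  f_equal. field. lra.
Qed.

(** Interpolating from [b + d] up to [b + 1] bounds [b * Gamma b] by
    [Rpower (b + d) (1 - d) * Gamma (b + d)]; Bernoulli's inequality then handles
    [Rpower (1 + d / b) (1 - d)]. *)
Lemma Gamma_ratio_le (b d : R) : 0 < b -> 0 <= d <= 1 ->
  Gamma b / Gamma (b + d) <= Rpower (/ b) d * (1 + / b).
Proof.
  intros hb hd.
  pose proof (Gamma_interpolation (b + d) (1 - d) ltac:(lra) ltac:(lra)) as h.
  replace (b + d + (1 - d)) with (b + 1) in h by ring.
  rewrite Gamma_S in h by (now apply nonpole_pos).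
  pose proof (Gamma_pos b hb) as g1.
  pose proof (Gamma_pos (b + d) ltac:(lra)) as g2.
  assert (ib : 0 < / b) by now apply Rinv_0_lt_compat.
  assert (e : Rpower (b + d) (1 - d) = b * (Rpower (/ b) d * Rpower (1 + d * / b) (1 - d))).
  { replace (b + d) with (b * (1 + d * / b)) by (field; lra).
    rewrite <- Rpower_mult_distr by nra.
    replace (/ b) with (Rpower b (Ropp 1)) at 2
      by (rewrite Rpower_Ropp, Rpower_1 by lra; reflexivity).
    rewrite Rpower_mult.
    replace (1 - d) with (Ropp 1 * d + 1) at 1 by ring.
    rewrite Rpower_S by lra. ring. }
  pose proof (Rpower_bernoulli (1 + d * / b) (1 - d) ltac:(nra) ltac:(lra)) as hbn.
  assert (h2 : Rpower (1 + d * / b) (1 - d) <= 1 + / b) by nra.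
  pose proof (Rpower_pos (/ b) d) as pp.
  apply Rmult_le_reg_r with (b * Gamma (b + d)); [nra|].
  replace (Gamma b / Gamma (b + d) * (b * Gamma (b + d))) with (b * Gamma b)
    by (field; lra).
  eapply Rle_trans; [exact h|]. rewrite e.
  transitivity (Rpower (/ b) d * Rpower (1 + d * / b) (1 - d) * (b * Gamma (b + d)));
    [right; ring|].
  apply Rmult_le_compat_r; [nra|]. apply Rmult_le_compat_l; lra.
Qed.

Lemma Gamma_ratio_ge (b d : R) : 0 < b -> 0 <= d <= 1 ->
  Rpower (/ b) d <= Gamma b / Gamma (b + d).
Proof.
  intros hb hd.
  pose proof (Gamma_interpolation b d hb hd) as h.
  pose proof (Gamma_pos b hb) as g1.
  pose proof (Gamma_pos (b + d) ltac:(lra)) as g2.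
  assert (ib : 0 < / b) by now apply Rinv_0_lt_compat.
  assert (e : Rpower (/ b) d * Rpower b d = 1).
  { rewrite Rpower_mult_distr, Rinv_l by lra. apply Rpower_base_1. }
  pose proof (Rpower_pos (/ b) d).
  apply Rmult_le_reg_r with (Gamma (b + d)); [exact g2|].
  replace (Gamma b / Gamma (b + d) * Gamma (b + d)) with
    (Rpower (/ b) d * Rpower b d * Gamma b) by (rewrite e; field; lra).
  rewrite Rmult_assoc. apply Rmult_le_compat_l; lra.
Qed.

(** With [b = k + nu + 1], raising the order by [d] multiplies the [k]-th term by at most
    [Rpower (x / (2 b)) d * (1 + / b)]. Bernoulli's inequality replaces the power by a convex
    combination of the terms of orders [nu] and [nu + 1], and the sums decrease from [nu] to
    [nu + 1]. *)
Lemma BesselI_order_le (nu d x : R) : 0 <= nu -> 0 <= d <= 1 -> 0 < x ->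
  BesselI (nu + d) x <= (1 + / (nu + 1)) * BesselI nu x.
Proof.
  intros hn hd hx.
  set (kap := 1 + / (nu + 1)).
  assert (hk : 0 < kap).
  { unfold kap. assert (0 < / (nu + 1)) by (apply Rinv_0_lt_compat; lra). lra. }
  apply Rle_trans with (kap * ((1 - d) * BesselI nu x + d * BesselI (nu + 1) x)).
  - assert (e1 : ex_series (bessel_term nu x)).
    { apply ex_series_BesselI; [exact hx|apply nonpole_pos; lra]. }
    assert (e2 : ex_series (bessel_term (nu + 1) x)).
    { apply ex_series_BesselI; [exact hx|apply nonpole_pos; lra]. }
    change (Series (bessel_term (nu + d) x) <=
      kap * ((1 - d) * Series (bessel_term nu x) + d * Series (bessel_term (nu + 1) x))).
    rewrite <- !Series_scal_l.
    rewrite <- Series_plus by (apply (ex_series_scal (V := R_NormedModule)); assumption).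
    rewrite <- Series_scal_l.
    apply Series_le.
    + intros k. split; [left; apply bessel_term_pos; lra|].
      pose proof (bessel_term_pos nu x k ltac:(lra)) as hp.
      rewrite bessel_term_plus, bessel_term_S by lra.
      pose proof (pos_INR k) as pk.
      set (b := INR k + nu + 1).
      assert (hb : 0 < b) by (unfold b; lra).
      assert (ib : 0 < / b) by now apply Rinv_0_lt_compat.
      pose proof (Gamma_ratio_le b d hb hd) as h1.
      assert (h2 : 1 + / b <= kap).
      { unfold kap. apply Rplus_le_compat_l, Rinv_le_contravar; unfold b; lra. }
      pose proof (Rpower_bernoulli (x / 2 * / b) d ltac:(nra) hd) as h3.
      rewrite <- Rpower_mult_distr in h3 by lra.
      pose proof (Rpower_pos (x / 2) d) as p1. pose proof (Rpower_pos (/ b) d) as p2.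
      transitivity (bessel_term nu x k * (kap * (1 - d + d * (x / 2 * / b))));
        [|right; unfold Rdiv; ring].
      apply Rmult_le_compat_l; [lra|].
      unfold Rdiv at 1. rewrite Rmult_assoc.
      apply Rle_trans with (Rpower (x / 2) d * (Rpower (/ b) d * kap)).
      * apply Rmult_le_compat_l; [lra|]. eapply Rle_trans; [exact h1|].
        apply Rmult_le_compat_l; lra.
      * rewrite <- Rmult_assoc, Rmult_comm. apply Rmult_le_compat_l; lra.
    + apply (ex_series_scal (V := R_NormedModule) kap).
      apply (ex_series_plus (V := R_NormedModule));
        apply (ex_series_scal (V := R_NormedModule)); assumption.
  - apply Rmult_le_compat_l; [lra|].
    pose proof (BesselI_S_le nu x hn hx). nra.
Qed.

(** The lower semicontinuity needed at integer order. Termwise the factor is at least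
    [1 + d (1 - 2 b / x)] with [b = k + nu + 1]: in [2 b / x] the part [k + nu] gives the term of
    order [nu - 1], and the remaining [1] gives [2 / x]. Negative terms are moved across, as
    [Series_le] compares nonnegative ones. *)
Lemma BesselI_order_ge (nu d x : R) : 0 < nu -> 0 <= d <= 1 -> 0 < x ->
  (1 + d) * BesselI nu x <=
  BesselI (nu + d) x + (d * (2 / x) * BesselI nu x + d * BesselI (nu - 1) x).
Proof.
  intros hn hd hx.
  assert (e1 : ex_series (bessel_term nu x)).
  { apply ex_series_BesselI; [exact hx|apply nonpole_pos; lra]. }
  assert (e2 : ex_series (bessel_term (nu - 1) x)).
  { apply ex_series_BesselI; [exact hx|apply nonpole_pos; lra]. }
  assert (e3 : ex_series (bessel_term (nu + d) x)).
  { apply ex_series_BesselI; [exact hx|apply nonpole_pos; lra]. }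
  assert (e4 : ex_series (fun k => d * (2 / x) * bessel_term nu x k
                                   + d * bessel_term (nu - 1) x k)).
  { apply (ex_series_plus (V := R_NormedModule));
      apply (ex_series_scal (V := R_NormedModule)); assumption. }
  change ((1 + d) * Series (bessel_term nu x) <= Series (bessel_term (nu + d) x) +
    (d * (2 / x) * Series (bessel_term nu x) + d * Series (bessel_term (nu - 1) x))).
  rewrite <- !Series_scal_l.
  rewrite <- (Series_plus (fun n => d * (2 / x) * bessel_term nu x n))
    by (apply (ex_series_scal (V := R_NormedModule)); assumption).
  rewrite <- Series_plus by assumption.
  apply Series_le; [|now apply (ex_series_plus (V := R_NormedModule))].
  intros k.
  pose proof (bessel_term_pos nu x k ltac:(lra)) as hp.
  pose proof (bessel_term_pos (nu - 1) x k ltac:(lra)) as hp1.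
  split; [nra|].
  pose proof (pos_INR k) as pk.
  assert (es : bessel_term (nu - 1) x k = bessel_term nu x k * ((INR k + nu) * (2 / x))).
  { replace nu with (nu - 1 + 1) at 2 by ring.
    rewrite bessel_term_S by lra. field. lra. }
  rewrite es, bessel_term_plus by lra.
  set (b := INR k + nu + 1).
  assert (hb : 0 < b) by (unfold b; lra).
  assert (ib : 0 < / b) by now apply Rinv_0_lt_compat.
  pose proof (Gamma_ratio_ge b d hb hd) as h1.
  pose proof (Rpower_ge_tangent (x / 2 * / b) d ltac:(nra) ltac:(lra)) as h3.
  rewrite <- Rpower_mult_distr in h3 by lra.
  pose proof (Rpower_pos (x / 2) d) as p1.
  replace (/ (x / 2 * / b)) with (b * (2 / x)) in h3 by (field; lra).
  assert (h4 : Rpower (x / 2) d * Rpower (/ b) d <=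
     Rpower (x / 2) d * Gamma b / Gamma (b + d)).
  { unfold Rdiv. rewrite Rmult_assoc. apply Rmult_le_compat_l; [unfold Rdiv in *; lra|exact h1]. }
  set (q := Rpower (x / 2) d * Gamma b / Gamma (b + d)) in *.
  transitivity (bessel_term nu x k * (q + d * (b * (2 / x)))).
  - rewrite Rmult_comm. apply Rmult_le_compat_l; lra.
  - right. unfold b. ring.
Qed.

(** * Ratios of orders as the argument tends to infinity *)

Lemma is_lim_mult_fin (f g : R -> R) (p : Rbar) (a b : R) :
  is_lim f p a -> is_lim g p b -> is_lim (fun x => f x * g x) p (a * b).
Proof. intros hf hg. now apply (is_lim_mult f g p a b). Qed.

Lemma eventually_pos : Rbar_locally p_infty (fun x => 0 < x).
Proof. exists 0. auto. Qed.

Lemma is_lim_div_p_infty (a : R) : is_lim (fun x => a / x) p_infty 0.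
Proof.
  replace (Finite 0) with (Rbar_mult a (Rbar_inv p_infty))
    by (simpl; f_equal; ring).
  apply is_lim_scal_l. apply is_lim_inv; [apply is_lim_id|discriminate].
Qed.

Lemma is_lim_BesselI_S (nu : R) : 1 / 2 <= nu ->
  is_lim (fun x => BesselI (nu + 1) x / BesselI nu x) p_infty 1.
Proof.
  intros hn.
  apply (is_lim_le_le_loc (fun x => 1 - (nu + 1 / 2) / x) (fun _ => 1)).
  - generalize eventually_pos. apply filter_imp. intros x hx.
    pose proof (BesselI_pos nu x hx ltac:(lra)) as hp.
    pose proof (BesselI_S_le nu x ltac:(lra) hx).
    pose proof (BesselI_S_ge nu x hn hx).
    assert (e : BesselI (nu + 1) x / BesselI nu x * BesselI nu x = BesselI (nu + 1) x)
      by (field; lra).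
    split; apply Rmult_le_reg_r with (BesselI nu x); try exact hp; rewrite e; lra.
  - replace (Finite 1) with (Finite (1 - 0)) by (f_equal; ring).
    apply is_lim_minus'; [apply is_lim_const|apply is_lim_div_p_infty].
  - apply is_lim_const.
Qed.

Lemma is_lim_ratio_trans (f g h : R -> R) :
  Rbar_locally p_infty (fun x => g x <> 0) ->
  is_lim (fun x => f x / g x) p_infty 1 -> is_lim (fun x => g x / h x) p_infty 1 ->
  is_lim (fun x => f x / h x) p_infty 1.
Proof.
  intros hg h1 h2.
  apply is_lim_ext_loc with (fun x => f x / g x * (g x / h x)).
  - revert hg. apply filter_imp. intros x hx. unfold Rdiv.
    rewrite <- Rmult_assoc, (Rmult_assoc (f x)), Rinv_l by assumption. ring.
  - replace (Finite 1) with (Finite (1 * 1)) by (f_equal; ring).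
    now apply (is_lim_mult_fin (fun x => f x / g x) (fun x => g x / h x)).
Qed.

Lemma BesselI_eventually_neq_0 (mu : R) : -1 < mu ->
  Rbar_locally p_infty (fun x => BesselI mu x <> 0).
Proof.
  intros h. generalize eventually_pos. apply filter_imp. intros x hx.
  pose proof (BesselI_pos mu x hx h). lra.
Qed.

Lemma is_lim_BesselI_plus_INR (nu : R) (n : nat) : 1 / 2 <= nu ->
  is_lim (fun x => BesselI (nu + INR n) x / BesselI nu x) p_infty 1.
Proof.
  intros hn. induction n as [|n IH].
  - simpl. rewrite Rplus_0_r.
    apply is_lim_ext_loc with (fun _ => 1); [|apply is_lim_const].
    generalize (BesselI_eventually_neq_0 nu ltac:(lra)). apply filter_imp.
    intros x hx. now field.
  - pose proof (pos_INR n).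
    apply is_lim_ratio_trans with (BesselI (nu + INR n)); [| |exact IH].
    + apply BesselI_eventually_neq_0. lra.
    + rewrite S_INR, <- Rplus_assoc. apply is_lim_BesselI_S. lra.
Qed.

Lemma is_lim_BesselI_minus_INR (nu : R) (n : nat) : 1 / 2 <= nu ->
  is_lim (fun x => BesselI nu x / BesselI (nu + INR n) x) p_infty 1.
Proof.
  intros hn.
  apply is_lim_ext with (fun x => / (BesselI (nu + INR n) x / BesselI nu x)).
  - intros x. rewrite Rinv_div. reflexivity.
  - replace (Finite 1) with (Rbar_inv 1) by (simpl; f_equal; field).
    apply is_lim_inv; [now apply is_lim_BesselI_plus_INR|].
    intros e. injection e. lra.
Qed.

Lemma is_lim_eventually_lt (f : R -> R) (l m : R) :
  is_lim f p_infty l -> l < m -> Rbar_locally p_infty (fun x => f x < m).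
Proof.
  intros h hlm. apply is_lim_spec in h.
  assert (he : 0 < m - l) by lra.
  specialize (h (mkposreal _ he)). simpl in h.
  destruct h as [M hM]. exists M. intros x hx. specialize (hM x hx).
  apply Rabs_def2 in hM. lra.
Qed.

Lemma is_lim_eventually_gt (f : R -> R) (l m : R) :
  is_lim f p_infty l -> m < l -> Rbar_locally p_infty (fun x => m < f x).
Proof.
  intros h hlm. apply is_lim_spec in h.
  assert (he : 0 < l - m) by lra.
  specialize (h (mkposreal _ he)). simpl in h.
  destruct h as [M hM]. exists M. intros x hx. specialize (hM x hx).
  apply Rabs_def2 in hM. lra.
Qed.

(* [BesselI_order_le] loses only a factor [1 + / m] at order [m], and raising both
   orders by an integer does not change the limit of their ratio. *)
Lemma is_lim_BesselI_order (nu d : R) : 1 / 2 <= nu -> 0 <= d <= 1 ->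
  is_lim (fun x => BesselI (nu + d) x / BesselI nu x) p_infty 1.
Proof.
  intros hn hd.
  apply is_lim_spec. intros eps.
  change (Rbar_locally p_infty
    (fun x => Rabs (BesselI (nu + d) x / BesselI nu x - 1) < eps)).
  (* This [m] satisfies [1 < m * eps], so that [/ (m + 1) < eps]. *)
  destruct (INR_archimed eps 1 (cond_pos eps)) as [m hm].
  assert (he : 0 < eps) by apply cond_pos.
  pose proof (pos_INR m) as pm.
  set (kap := 1 + / (INR m + 1)).
  assert (hk : 1 < kap < 1 + eps).
  { unfold kap.
    assert (0 < / (INR m + 1)) by (apply Rinv_0_lt_compat; lra).
    split; [lra|]. apply Rplus_lt_compat_l.
    apply Rmult_lt_reg_r with (INR m + 1); [lra|]. rewrite Rinv_l by lra. nra. }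
  pose proof (is_lim_BesselI_minus_INR (nu + d) m ltac:(lra)) as l1.
  pose proof (is_lim_BesselI_plus_INR nu m hn) as l2.
  pose proof (is_lim_BesselI_plus_INR nu (S m) hn) as l3.
  assert (lu : is_lim (fun x => BesselI (nu + d) x / BesselI (nu + d + INR m) x
      * (BesselI (nu + INR m) x / BesselI nu x) * kap) p_infty (1 * 1 * kap)).
  { apply is_lim_mult_fin; [|apply is_lim_const]. now apply is_lim_mult_fin. }
  assert (ll : is_lim (fun x => BesselI (nu + d) x / BesselI (nu + d + INR m) x
      * (BesselI (nu + INR (S m)) x / BesselI nu x) * / kap) p_infty (1 * 1 * / kap)).
  { apply is_lim_mult_fin; [|apply is_lim_const]. now apply is_lim_mult_fin. }
  assert (hik : 1 - eps < / kap).
  { apply Rmult_lt_reg_r with kap; [lra|]. rewrite Rinv_l by lra. nra. }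
  pose proof (is_lim_eventually_lt _ _ (1 + eps) lu ltac:(lra)) as vu.
  pose proof (is_lim_eventually_gt _ _ (1 - eps) ll ltac:(lra)) as vl.
  generalize (filter_and _ _ eventually_pos (filter_and _ _ vu vl)).
  apply filter_imp. intros x [hx [hu hl]]. cbv beta in hu, hl.
  assert (hkb : forall b, INR m <= b -> 1 + / (b + 1) <= kap).
  { intros b hb. unfold kap. apply Rplus_le_compat_l, Rinv_le_contravar; lra. }
  (* Going up by [d] from [nu + m], then by [1 - d] to [nu + m + 1], traps the order [nu + d + m]
     between two integer shifts of [nu], up to [kap]. *)
  pose proof (BesselI_order_le (nu + INR m) d x ltac:(lra) hd hx) as i1.
  pose proof (BesselI_order_le (nu + d + INR m) (1 - d) x ltac:(lra) ltac:(lra) hx) as i2.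
  replace (nu + INR m + d) with (nu + d + INR m) in i1 by ring.
  replace (nu + d + INR m + (1 - d)) with (nu + INR (S m)) in i2 by (rewrite S_INR; ring).
  pose proof (hkb (nu + INR m) ltac:(lra)) as k1.
  pose proof (hkb (nu + d + INR m) ltac:(lra)) as k2.
  pose proof (BesselI_pos nu x hx ltac:(lra)) as p0.
  pose proof (BesselI_pos (nu + d) x hx ltac:(lra)) as p1.
  pose proof (BesselI_pos (nu + d + INR m) x hx ltac:(lra)) as p2.
  pose proof (BesselI_pos (nu + INR m) x hx ltac:(lra)) as p3.
  set (I0 := BesselI nu x) in *. set (Id := BesselI (nu + d) x) in *.
  set (Idm := BesselI (nu + d + INR m) x) in *. set (Im := BesselI (nu + INR m) x) in *.
  set (Im1 := BesselI (nu + INR (S m)) x) in *.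
  assert (j1 : Idm <= kap * Im) by nra.
  assert (j2 : Im1 <= kap * Idm) by nra.
  assert (hq : 0 < Id / (Idm * I0)) by (apply Rdiv_lt_0_compat; nra).
  assert (hQ : Id / I0 = Id / (Idm * I0) * Idm) by (field; lra).
  replace (Id / Idm * (Im / I0) * kap) with (Id / (Idm * I0) * (kap * Im)) in hu
    by (field; lra).
  replace (Id / Idm * (Im1 / I0) * / kap) with (Id / (Idm * I0) * (Im1 * / kap)) in hl
    by (field; lra).
  assert (j3 : Im1 * / kap <= Idm).
  { apply Rmult_le_reg_r with kap; [lra|]. rewrite Rmult_assoc, Rinv_l by lra. lra. }
  apply Rabs_def1; rewrite hQ; nra.
Qed.

(** In the recurrence for lower orders the term with [/ x] disappears in the limit. Two consecutive
    orders are carried along, since the recurrence has two steps. *)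
Lemma is_lim_BesselI_descend (D : R -> R) (n : nat) (mu : R) :
  (forall k : nat, nonpole (mu - INR k + 1)) ->
  is_lim (fun x => BesselI mu x / D x) p_infty 1 ->
  is_lim (fun x => BesselI (mu + 1) x / D x) p_infty 1 ->
  is_lim (fun x => BesselI (mu - INR n) x / D x) p_infty 1.
Proof.
  intros hp h0 h1.
  enough (h : is_lim (fun x => BesselI (mu - INR n) x / D x) p_infty 1 /\
    is_lim (fun x => BesselI (mu - INR n + 1) x / D x) p_infty 1) by apply h.
  induction n as [|n [IH1 IH2]].
  - simpl. rewrite Rminus_0_r. split; assumption.
  - replace (mu - INR (S n) + 1) with (mu - INR n) by (rewrite S_INR; ring).
    split; [|exact IH1].
    specialize (hp (S n)).
    apply is_lim_ext_loc with (fun x =>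
      2 * (mu - INR (S n) + 1) / x * (BesselI (mu - INR n) x / D x)
      + BesselI (mu - INR n + 1) x / D x).
    + generalize eventually_pos. apply filter_imp. intros x hx.
      rewrite (BesselI_rec (mu - INR (S n))) by assumption.
      replace (mu - INR (S n) + 2) with (mu - INR n + 1) by (rewrite S_INR; ring).
      replace (mu - INR (S n) + 1) with (mu - INR n) by (rewrite S_INR; ring).
      unfold Rdiv. ring.
    + replace (Finite 1) with (Finite (0 * 1 + 1)) by (f_equal; ring).
      apply is_lim_plus'; [|exact IH2].
      apply is_lim_mult_fin; [apply is_lim_div_p_infty|exact IH1].
Qed.

(** * The product of I and K *)

Definition noninteger (z : R) : Prop := forall k : Z, z <> IZR k.

Lemma noninteger_nonpole (z : R) (k : Z) : noninteger z ->
  nonpole (z + IZR k) /\ nonpole (- z + IZR k).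
Proof.
  intros h. split; intros n e; rewrite INR_IZR_INZ in e.
  - apply (h (- k - Z.of_nat n)%Z). rewrite minus_IZR, opp_IZR. lra.
  - apply (h (k + Z.of_nat n)%Z). rewrite plus_IZR. lra.
Qed.

Lemma noninteger_nonpole_1 (z : R) : noninteger z -> nonpole (1 + z) /\ nonpole (1 - z).
Proof.
  intros h. destruct (noninteger_nonpole z 1 h) as [h1 h2].
  split; [rewrite Rplus_comm|unfold Rminus; rewrite Rplus_comm]; assumption.
Qed.

(** With [N = up (2 * nu)] and [d = N - 2 * nu], the order [- nu] is [nu + d - N]: a fractional
    shift up, then [N] integer steps down. *)
Lemma is_lim_BesselI_opp (nu : R) : 1 / 2 <= nu -> noninteger nu ->
  is_lim (fun x => BesselI (- nu) x / BesselI nu x) p_infty 1.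
Proof.
  intros hn hi.
  destruct (archimed (2 * nu)) as [a1 a2].
  assert (hz : (0 <= up (2 * nu))%Z) by (apply le_IZR; lra).
  set (N := Z.to_nat (up (2 * nu))).
  assert (hN : INR N = IZR (up (2 * nu))) by (unfold N; rewrite INR_IZR_INZ, Z2Nat.id; auto).
  set (d := INR N - 2 * nu).
  assert (hd : 0 <= d <= 1) by (unfold d; lra).
  replace (- nu) with (nu + d - INR N) by (unfold d; ring).
  apply is_lim_BesselI_descend.
  - intros k. unfold d.
    replace (nu + (INR N - 2 * nu) - INR k + 1) with
      (- nu + IZR (Z.of_nat N - Z.of_nat k + 1)).
    + apply noninteger_nonpole, hi.
    + rewrite plus_IZR, minus_IZR, <- !INR_IZR_INZ. ring.
  - now apply is_lim_BesselI_order.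
  - apply is_lim_ratio_trans with (BesselI (nu + d)).
    + apply BesselI_eventually_neq_0. lra.
    + apply is_lim_BesselI_S. lra.
    + now apply is_lim_BesselI_order.
Qed.

Lemma sin_noninteger (nu : R) : noninteger nu -> sin (nu * PI) <> 0.
Proof.
  intros h e. apply sin_eq_0_0 in e. destruct e as [k e].
  apply (h k). apply (Rmult_eq_reg_r PI); [exact e|apply PI_neq0].
Qed.

Lemma BesselI_ratio_series (nu x : R) : 0 < x -> 0 <= nu ->
  BesselI (- nu) x / BesselI nu x =
  Rpower (x / 2) (- 2 * nu) * bessel_series (- nu) (x ^ 2 / 4) / bessel_series nu (x ^ 2 / 4).
Proof.
  intros hx hn. rewrite !BesselI_series by assumption.
  replace (- nu) with (nu + (- 2 * nu)) at 1 by ring.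
  rewrite Rpower_plus.
  pose proof (Rpower_pos (x / 2) nu).
  pose proof (bessel_series_pos nu (x ^ 2 / 4) ltac:(lra) ltac:(nra)).
  field. split; lra.
Qed.

(* This is [K / I - 1 / (2 x I^2)] at order [nu]. *)
Definition bessel_defect (nu x : R) : R :=
  PI / (2 * sin (nu * PI)) *
    (Rpower (x / 2) (- 2 * nu) * bessel_series (- nu) (x ^ 2 / 4)
       / bessel_series nu (x ^ 2 / 4) - 1)
  - Rpower (x / 2) (- 2 * nu) / (2 * x * bessel_series nu (x ^ 2 / 4) ^ 2).

(* The Wronskian gives [(K / I)' = - 1 / (x I^2)], and then [y' > y] for
   [y = sqrt x * I] makes the derivative positive. *)
Lemma is_derive_bessel_defect (nu x : R) : 0 < x -> 1 / 2 <= nu -> noninteger nu ->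
  is_derive (bessel_defect nu) x
    (Rpower (x / 2) (- 2 * nu) / (x ^ 2 * bessel_series nu (x ^ 2 / 4) ^ 3) *
      ((nu + 1 / 2) * bessel_series nu (x ^ 2 / 4)
      + x ^ 2 / 2 * bessel_series (nu + 1) (x ^ 2 / 4) - x * bessel_series nu (x ^ 2 / 4))).
Proof.
  intros hx hn hi.
  destruct (noninteger_nonpole_1 nu hi) as [q1 q2].
  assert (p1 : nonpole (nu + 1)) by now rewrite Rplus_comm.
  assert (p2 : nonpole (- nu + 1)) by now rewrite Rplus_comm.
  pose proof (is_derive_bessel_series_sq nu x p1) as dA.
  pose proof (is_derive_bessel_series_sq (- nu) x p2) as dB.
  pose proof (bessel_wronskian nu (x ^ 2 / 4) q1 q2) as hW.
  pose proof (bessel_series_pos nu (x ^ 2 / 4) ltac:(lra) ltac:(nra)) as hA.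
  pose proof (sin_noninteger nu hi) as hs.
  rewrite (Rmult_comm PI nu) in hW.
  assert (dp : is_derive (fun x => Rpower (x / 2) (- 2 * nu)) x
     (- 2 * nu / x * Rpower (x / 2) (- 2 * nu))).
  { unfold Rpower. auto_derive; [lra|]. unfold Rdiv. field. lra. }
  unfold bessel_defect.
  (* Named functions keep [auto_derive] from unfolding the series and the power; their known
     derivatives are substituted afterwards. *)
  set (fA := fun x : R => bessel_series nu (x ^ 2 / 4)) in *.
  set (fB := fun x : R => bessel_series (- nu) (x ^ 2 / 4)) in *.
  set (fp := fun x : R => Rpower (x / 2) (- 2 * nu)) in *.
  apply (is_derive_ext (fun x => PI / (2 * sin (nu * PI)) * (fp x * fB x / fA x - 1)
    - fp x / (2 * x * fA x ^ 2))); [reflexivity|].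
  change (bessel_series nu (x ^ 2 / 4)) with (fA x) in *.
  change (bessel_series (- nu) (x ^ 2 / 4)) with (fB x) in *.
  change (Rpower (x / 2) (- 2 * nu)) with (fp x) in *.
  set (A1 := bessel_series (nu + 1) (x ^ 2 / 4)) in *.
  set (B1 := bessel_series (- nu + 1) (x ^ 2 / 4)) in *.
  pose proof PI_neq0 as hpi.
  auto_derive.
  - repeat split; try (eexists; eassumption); try lra.
    simpl. repeat apply Rmult_integral_contrapositive_currified; lra.
  - rewrite (is_derive_unique (fun x : R => fA x) _ _ dA),
      (is_derive_unique (fun x : R => fB x) _ _ dB),
      (is_derive_unique (fun x : R => fp x) _ _ dp).
    (* The Wronskian solved for [B1], the only derivative of the order [- nu] series; what remains
       is a rational identity. *)
    assert (eB : B1 = (- 2 * sin (nu * PI) / PI + 2 * nu * fA x * fB x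
       + 2 * (x ^ 2 / 4) * A1 * fB x) / (2 * (x ^ 2 / 4) * fA x)).
    { rewrite <- hW. field. split; lra. }
    rewrite eB. field. repeat split; lra.
Qed.

Lemma bessel_defect_incr (nu x y : R) : 0 < x -> x < y -> 1 / 2 <= nu -> noninteger nu ->
  bessel_defect nu x < bessel_defect nu y.
Proof.
  intros hx hxy hn hi.
  apply (incr_function (bessel_defect nu) 0 p_infty
    (fun x => Rpower (x / 2) (- 2 * nu) / (x ^ 2 * bessel_series nu (x ^ 2 / 4) ^ 3) *
      ((nu + 1 / 2) * bessel_series nu (x ^ 2 / 4)
      + x ^ 2 / 2 * bessel_series (nu + 1) (x ^ 2 / 4)
      - x * bessel_series nu (x ^ 2 / 4)))); try assumption; try exact I.
  - intros s hs _. now apply is_derive_bessel_defect.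
  - intros s hs _. simpl in hs.
    pose proof (bessel_series_pos nu (s ^ 2 / 4) ltac:(lra) ltac:(nra)) as hA.
    apply Rmult_lt_0_compat; [|apply bessel_series_log_derive; lra].
    apply Rdiv_lt_0_compat; [apply Rpower_pos|].
    apply Rmult_lt_0_compat; apply pow_lt; assumption.
Qed.

(** The defect at [x] is below its value at every larger [y], hence below [K / I] at [y], which
    tends to [0]. *)
Lemma bessel_defect_le_0 (nu x : R) : 0 < x -> 1 / 2 <= nu -> noninteger nu ->
  bessel_defect nu x <= 0.
Proof.
  intros hx hn hi.
  set (c := PI / (2 * sin (nu * PI))).
  assert (hl : is_lim (fun y => c * (BesselI (- nu) y / BesselI nu y - 1)) p_infty 0).
  { replace (Finite 0) with (Finite (c * (1 - 1))) by (f_equal; ring).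
    apply is_lim_mult_fin; [apply is_lim_const|].
    apply is_lim_minus'; [now apply is_lim_BesselI_opp|apply is_lim_const]. }
  apply (is_lim_le_loc (fun _ => bessel_defect nu x)
    (fun y => c * (BesselI (- nu) y / BesselI nu y - 1)) p_infty
    (bessel_defect nu x) 0); [|apply is_lim_const|exact hl].
  exists x. intros y hy.
  pose proof (bessel_defect_incr nu x y hx hy hn hi) as h.
  rewrite BesselI_ratio_series by lra.
  unfold bessel_defect at 2 in h. fold c in h.
  pose proof (bessel_series_pos nu (y ^ 2 / 4) ltac:(lra) ltac:(nra)) as hA.
  assert (0 < Rpower (y / 2) (- 2 * nu) / (2 * y * bessel_series nu (y ^ 2 / 4) ^ 2)).
  { apply Rdiv_lt_0_compat; [apply Rpower_pos|].
    apply Rmult_lt_0_compat; [lra|now apply pow_lt]. }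
  lra.
Qed.

(** Multiplying the defect by [BesselI nu x ^ 2] gives the difference of the two sides. *)
Lemma BesselI_mul_K_quot_le (nu x : R) : 0 < x -> 1 / 2 <= nu -> noninteger nu ->
  BesselI nu x * BesselK_quot x nu <= 1 / (2 * x).
Proof.
  intros hx hn hi.
  pose proof (bessel_defect_le_0 nu x hx hn hi) as h.
  unfold bessel_defect in h.
  rewrite <- BesselI_ratio_series in h by lra.
  pose proof (sin_noninteger nu hi) as hs.
  pose proof (BesselI_pos nu x hx ltac:(lra)) as hp.
  pose proof (bessel_series_pos nu (x ^ 2 / 4) ltac:(lra) ltac:(nra)) as hA.
  assert (e : Rpower (x / 2) (- 2 * nu) / (2 * x * bessel_series nu (x ^ 2 / 4) ^ 2)
     = 1 / (2 * x) / BesselI nu x ^ 2).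
  { rewrite BesselI_series by assumption.
    replace (- 2 * nu) with (- nu + - nu) by ring.
    rewrite Rpower_plus, Rpower_Ropp.
    pose proof (Rpower_pos (x / 2) nu). field. repeat split; lra. }
  rewrite e in h. unfold BesselK_quot.
  assert (hp2 : 0 < BesselI nu x ^ 2) by now apply pow_lt.
  apply Rmult_le_compat_r with (r := BesselI nu x ^ 2) in h; [|lra].
  rewrite Rmult_0_l in h.
  match type of h with ?l <= 0 =>
    replace l with (BesselI nu x * (PI / 2 * ((BesselI (- nu) x - BesselI nu x) / sin (nu * PI)))
      - 1 / (2 * x)) in h by (field; repeat split; lra) end.
  lra.
Qed.

(** * Passage to integer order *)

Lemma noninteger_between (k : Z) (d : R) : 0 < d < 1 -> noninteger (IZR k + d).
Proof.
  intros hd m e.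
  assert (h1 : IZR k < IZR m) by lra.
  assert (h2 : IZR m < IZR (k + 1)) by (rewrite plus_IZR; lra).
  apply lt_IZR in h1. apply lt_IZR in h2. lia.
Qed.

(** [Lim] at [nu] is by definition [Lim_seq] along [nu + / (INR n + 1)]. On these orders the
    noninteger bound holds, and [BesselI_order_ge] replaces [BesselI] at the shifted order by a
    lower bound that converges to [BesselI nu x]. *)
Lemma BesselI_mul_K_integer_le (k : Z) (x : R) : 0 < x -> (1 <= k)%Z ->
  BesselI (IZR k) x * real (Lim (BesselK_quot x) (IZR k)) <= 1 / (2 * x).
Proof.
  intros hx hk. set (nu := IZR k).
  assert (hn : 1 <= nu) by (unfold nu; now apply (IZR_le 1)).
  pose proof (BesselI_pos nu x hx ltac:(lra)) as hp.
  assert (hx2 : 0 < / (2 * x)) by (apply Rinv_0_lt_compat; lra).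
  set (C := 2 / x * BesselI nu x + BesselI (nu - 1) x).
  set (del := fun n : nat => / (INR n + 1)).
  assert (ld : is_lim_seq del 0).
  { apply is_lim_seq_ext with (fun n => / (1 + INR n));
      [intros n; unfold del; f_equal; ring|apply is_lim_seq_inv_INR]. }
  assert (lb : is_lim_seq (fun n => (1 + del n) * BesselI nu x - del n * C) (BesselI nu x)).
  { replace (Finite (BesselI nu x)) with (Finite ((1 + 0) * BesselI nu x - 0 * C))
      by (f_equal; ring).
    apply is_lim_seq_minus'; apply is_lim_seq_mult';
      try apply is_lim_seq_const; try exact ld.
    apply is_lim_seq_plus'; [apply is_lim_seq_const|exact ld]. }
  assert (lv : is_lim_seq (fun n => 1 / (2 * x) / ((1 + del n) * BesselI nu x - del n * C))
     (1 / (2 * x) / BesselI nu x)).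
  { apply is_lim_seq_div'; [apply is_lim_seq_const|exact lb|lra]. }
  assert (ev : eventually (fun n => 0 < (1 + del n) * BesselI nu x - del n * C)).
  { apply is_lim_seq_spec in lb. destruct (lb (mkposreal _ hp)) as [N hN].
    exists N. intros n hn'. specialize (hN n hn'). simpl in hN.
    apply Rabs_def2 in hN. lra. }
  assert (hle : Rbar_le (Lim (BesselK_quot x) nu) (1 / (2 * x) / BesselI nu x)).
  { rewrite <- (is_lim_seq_unique _ _ lv). unfold Lim.
    apply Lim_seq_le_loc. destruct ev as [N hN].
    (* At [n = 0] the shift is [1] and the order is again an integer; it is noninteger from [n = 1]
       on. *)
    exists (S N). intros n hn'. specialize (hN n ltac:(lia)). simpl Rbar_loc_seq.
    fold (del n).
    assert (h1 : 0 < del n < 1).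
    { unfold del. assert (1 <= INR n) by (apply one_le_INR; lia).
      split; [apply Rinv_0_lt_compat; lra|].
      rewrite <- Rinv_1. apply Rinv_lt_contravar; lra. }
    pose proof (BesselI_mul_K_quot_le (nu + del n) x hx ltac:(lra)
      (noninteger_between k (del n) h1)) as h2.
    pose proof (BesselI_order_ge nu (del n) x ltac:(lra) ltac:(lra) hx) as h3.
    pose proof (BesselI_pos (nu + del n) x hx ltac:(lra)) as hpd.
    assert (h4 : (1 + del n) * BesselI nu x - del n * C <= BesselI (nu + del n) x)
      by (unfold C; lra).
    apply Rle_trans with (1 / (2 * x) / BesselI (nu + del n) x).
    - apply Rmult_le_reg_l with (BesselI (nu + del n) x); [exact hpd|].
      replace (BesselI (nu + del n) x * (1 / (2 * x) / BesselI (nu + del n) x))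
        with (1 / (2 * x)) by (field; lra). exact h2.
    - unfold Rdiv at 1 3. apply Rmult_le_compat_l; [unfold Rdiv; lra|].
      now apply Rinv_le_contravar. }
  (* The bound excludes [p_infty]; at [m_infty] the value of [real] is [0] and the claim is
     [0 <= 1 / (2 * x)]. *)
  destruct (Lim (BesselK_quot x) nu) as [l| |]; simpl in hle |- *.
  - apply Rmult_le_compat_l with (r := BesselI nu x) in hle; [|lra].
    replace (BesselI nu x * (1 / (2 * x) / BesselI nu x)) with (1 / (2 * x)) in hle
      by (field; lra). exact hle.
  - destruct hle.
  - rewrite Rmult_0_r. unfold Rdiv. lra.
Qed.

Theorem theorem4 (x nu : R) (hx : 0 < x) (hnu : 1 / 2 <= nu) :
  BesselI nu x * BesselK nu x - 1 / (2 * x) < 1 / (16 * x ^ 2).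
Proof.
  (* Strictness comes only from the positivity of [1 / (16 * x ^ 2)]. *)
  assert (h : BesselI nu x * BesselK nu x <= 1 / (2 * x)).
  { unfold BesselK. destruct (Req_EM_T (frac_part nu) 0) as [e|e].
    - destruct (fp_nat nu e) as [k ->].
      apply BesselI_mul_K_integer_le; [exact hx|].
      (* An integer that is at least [1 / 2] is at least [1]. *)
      assert (hk : 0 < IZR k) by lra. apply (lt_IZR 0) in hk. lia.
    - apply BesselI_mul_K_quot_le; try assumption.
      intros k ek. apply e. unfold frac_part.
      rewrite <- (Int_part_spec nu k) by lra. lra. }
  assert (0 < 1 / (16 * x ^ 2)).
  { apply Rdiv_lt_0_compat; [lra|]. pose proof (pow_lt x 2 hx). lra. }
  lra.
Qed.
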